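(* There exist absolute constants $\alpha, \beta > 0$ such that for every constant $c > 0$ there are constants $C_1, C_2 > 0$ (depending only on $c$) with the following property. Let $n \ge 1$, $p \ge 1$, and let $\varepsilon, \delta$ satisfy $p^{-1/3} \le \varepsilon \le 1/2$, $\delta \ge p^{-c}$, $\delta \ge \alpha e^{-\beta\varepsilon^2 p}$, $\delta < 1$, and $1/\delta \in \mathbb{N}$. Consider the multi-processor smoothed greedy algorithm on $n$ cups for the renormalized multi-processor cup game with parameters $p,\varepsilon,\delta$. Then for every oblivious filler, every step $i$, and every real $k \ge \log p$, the backlog after step $i$ is at most $C_1 k/\varepsilon$ with probability at least $1 - C_2 e^{-e^{k}}$.
   Context: Renormalized multi-processor cup game with parameters $p,\varepsilon,\delta$: $n$ cups, initially empty; in each step the filler pours nonnegative amounts $c_j(i) \le 1$ into the cups with $\sum_j c_j(i) \le (1-\varepsilon)p$, then the emptier selects up to $p+1$ distinct cups and removes up to $1+2\delta$ units from each. The filler is oblivious (all amounts fixed in advance, independent of the emptier's randomness). The backlog after a step is the maximum fill of any cup. Thresholds (defined for $1/\delta = D \in \mathbb{N}$): for each cup $j$ and each integer $i \ge 1$ with $i \equiv 1 \pmod{D+1}$, draw an independent uniform $s_j(i) \in (0,1]$; the thresholds of cup $j$ are all numbers $(i+t) + s_j(i)$ for $t = 1,\dots,D$ and such $i$ (there are no other thresholds). Let $a_j(i)$ be the total water poured by the filler into cup $j$ during the first $i$ steps ($a_j(0)=0$). Cup $j$ crosses a threshold $x$ in step $i$ if $a_j(i-1) < x \le a_j(i)$.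 Multi-processor smoothed greedy algorithm: each cup $j$ has a counter $w_j$, initially $0$. In each step, after the filler pours, $w_j$ is increased by $1+\delta$ for each threshold of cup $j$ crossed in that step. The emptier then selects up to $p+1$ distinct cups, giving priority to cups with $w_j \ge 1+\delta$ over all other cups, and to cups with $w_j \ne 0$ over cups with $w_j = 0$; within each priority level it selects the fullest cups. From each selected cup $j$ it removes $t_j = \min(1+2\delta, w_j)$ units of water and sets $w_j \leftarrow w_j - t_j$. *)

(* Defs.v *)
From HB Require Import structures.
From mathcomp Require Import all_boot all_order all_algebra.
From mathcomp Require Import finmap.
From mathcomp Require Import all_classical all_reals all_analysis.

Set Implicit Arguments.
Unset Strict Implicit.
Unset Printing Implicit Defensive.

Import Order.TTheory GRing.Theory Num.Theory.
Import numFieldNormedType.Exports.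

Local Open Scope classical_set_scope.
Local Open Scope ring_scope.

(** Steps are numbered from 1; [c i j] is the amount poured into cup [j] in step
    [i], and [c 0] is never used.  Obliviousness of the filler is expressed by
    [c] being a deterministic function, fixed before the randomness. *)
Definition oblivious_filler (R : realType) (n p : nat) (eps : R)
    (c : nat -> 'I_n -> R) : Prop :=
  forall i : nat, (0 < i)%N ->
    (forall j : 'I_n, 0 <= c i j <= 1) /\
    \sum_(j < n) c i j <= (1 - eps) * p%:R.

(** a_j(i) *)
Definition poured_total (R : realType) (n : nat) (c : nat -> 'I_n -> R)
    (j : 'I_n) (i : nat) : R :=
  \sum_(1 <= l < i.+1) c l j.

Definition block_start (D i : nat) : bool :=
  (0 < i)%N && (i == 1 %[mod D.+1]).

Definition thresholds (R : realType) (D : nat) (sj : nat -> R) : set R :=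
  [set x | exists i t : nat,
     [/\ block_start D i, (1 <= t <= D)%N & x = (i + t)%:R + sj i]].

Definition crossed (R : realType) (n D : nat) (c : nat -> 'I_n -> R)
    (s : 'I_n -> nat -> R) (j : 'I_n) (i : nat) : set R :=
  thresholds D (s j) `&`
  [set x | poured_total c j i.-1 < x <= poured_total c j i].

Record state (R : realType) (n : nat) := State {
  fill : 'I_n -> R;
  counter : 'I_n -> R }.

Definition init_state (R : realType) (n : nat) : state R n :=
  State (fun=> 0) (fun=> 0).

(** Only finitely many thresholds of a cup are crossed in a step (provided the
    offsets lie in (0,1]), so the finitely supported sum is the honest one. *)
Definition pour_step (R : realType) (n D : nat) (delta : R)
    (c : nat -> 'I_n -> R) (s : 'I_n -> nat -> R) (i : nat)
    (u : state R n) : state R n :=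
  State (fun j => fill u j + c i j)
        (fun j => counter u j + \sum_(x \in crossed D c s j i) (1 + delta)).

(** No truncation at 0 is needed in [fill]: the fill minus the counter of a cup
    equals a_j - (1+delta) * (number of thresholds <= a_j), which is >= 0. *)
Definition empty_step (R : realType) (n : nat) (delta : R) (A : {set 'I_n})
    (u : state R n) : state R n :=
  let removed j :=
    if j \in A then Num.min (1 + 2 * delta) (counter u j) else 0 in
  State (fun j => fill u j - removed j) (fun j => counter u j - removed j).

Definition priority (R : realType) (delta w : R) : nat :=
  if 1 + delta <= w then 2%N else if w != 0 then 1%N else 0%N.

(** [A] is a legal choice of the emptier in the (already poured) state [u].
    Ties between equally full cups may be broken in any way.  Fewer than [p + 1]
    cups may be selected only if every cup with nonzero counter is selected
    (selecting a cup with counter 0 has no effect). *)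
Definition greedy_selection (R : realType) (n p : nat) (delta : R)
    (u : state R n) (A : {set 'I_n}) : Prop :=
  [/\ (#|A| <= p.+1)%N,
      ((#|A| < p.+1)%N -> forall j : 'I_n, counter u j != 0 -> j \in A)
    & forall j l : 'I_n, j \in A -> l \notin A ->
        (priority delta (counter u l) <= priority delta (counter u j))%N /\
        (priority delta (counter u l) = priority delta (counter u j) ->
         fill u l <= fill u j)].

(** State after step [i], when the cups selected in step [k] are [sel k]. *)
Fixpoint run (R : realType) (n D : nat) (delta : R) (c : nat -> 'I_n -> R)
    (s : 'I_n -> nat -> R) (sel : nat -> {set 'I_n}) (i : nat) : state R n :=
  if i is i'.+1 then
    empty_step delta (sel i)
      (pour_step D delta c s i (run D delta c s sel i'))
  else init_state R n.

Definition smoothed_greedy (R : realType) (n p D : nat) (delta : R)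
    (c : nat -> 'I_n -> R) (s : 'I_n -> nat -> R)
    (sel : nat -> {set 'I_n}) : Prop :=
  forall i : nat,
    greedy_selection p delta
      (pour_step D delta c s i.+1 (run D delta c s sel i)) (sel i.+1).

(** Fills are nonnegative, so starting the maximum at 0 is harmless. *)
Definition backlog (R : realType) (n : nat) (u : state R n) : R :=
  \big[Num.max/0]_(j < n) fill u j.

(** Mutual independence of the family [X i], [i \in J]: the product rule over
    every finite subfamily. *)
Definition mutually_independent (R : realType) (d : measure_display)
    (T : measurableType d) (P : probability T R) (I : choiceType) (J : set I)
    (X : I -> {RV P >-> R}) : Prop :=
  forall (F : {fset I}) (B : I -> set R),
    [set` F] `<=` J ->
    (forall i, i \in F -> measurable (B i)) ->
    P (\bigcap_(i in [set` F]) (X i @^-1` B i)) =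
    (\prod_(i <- F) P (X i @^-1` B i))%E.

(** [uniform_prob ltr01] is carried by [0,1]; the first clause selects (0,1].
    The laws are compared on measurable sets only, because neither set function
    is meaningful elsewhere. *)
Definition uniform01 (R : realType) (d : measure_display)
    (T : measurableType d) (P : probability T R) (X : {RV P >-> R}) : Prop :=
  (forall w : T, 0 < X w <= 1) /\
  (forall B : set R, measurable B ->
     distribution P X B = uniform_prob (@ltr01 R) B).

Definition random_offsets (R : realType) (d : measure_display)
    (T : measurableType d) (P : probability T R) (n D : nat)
    (s : 'I_n -> nat -> {RV P >-> R}) : Prop :=
  (forall (j : 'I_n) (i : nat), block_start D i -> uniform01 (s j i)) /\
  mutually_independent [set ji : 'I_n * nat | block_start D ji.2]
    (fun ji => s ji.1 ji.2).

(* Main.v *)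
(* Cups with nonzero counter are "busy".  Call a step full if more than p cups
   are busy after pouring, and call a time at which all counters vanish a reset.

   Since a crossing adds 1 + delta and a selection removes 1 + 2 delta, a
   counter drops by at least delta in a non-full step, so an interval of length
   T without resets contains at least about delta T full steps.  Counting the
   selections still needed (ceil(w / (1 + 2 delta)) per cup), these full steps
   must carry on average more than p crossings each, whence
   sum_t (X_t - (1 - eps/2) p)^+ >= eps p delta T / 4, where X_t is the number of
   crossings in step t.  The expectation of the left side is at most half of
   this by Chernoff's bound (here alpha and beta enter), and it is a Lipschitz
   function of the independent offsets, each of which is responsible for at most
   D = 1/delta crossings; a Bernstein inequality bounds the failure probability
   by exp(- delta^3 T / 2048).  Hence, except with probability exp(-e^k), there is
   a reset among the last M = O(e^k / delta^6) = e^(O(k)) steps.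

   After a reset no randomness is needed.  The fill exceeds the counter by at
   most 3, so cups of fill above 5 have top priority and are emptied greedily;
   the potential sum_j (e^(eps max(fill_j, 5)) - e^(5 eps)) then grows by at most
   p e^(6 eps) per step, so all fills are O(log(M p) / eps) = O(k / eps). *)

Require Import Defs.
From HB Require Import structures.
From mathcomp Require Import all_boot all_order all_algebra.
From mathcomp Require Import finmap zify ring lra.
From mathcomp Require Import all_classical all_reals all_analysis measurable_realfun.

Set Implicit Arguments.
Unset Strict Implicit.
Unset Printing Implicit Defensive.

Import Order.TTheory GRing.Theory Num.Theory.
Import numFieldNormedType.Exports.

Local Open Scope classical_set_scope.
Local Open Scope ring_scope.

(** * The dynamics of the counters *)

(* The counter of cup [j] in units of [delta = 1 / D]: a crossing adds
   [1 + delta], i.e. [D + 1] units, and a removal takes away at most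
   [1 + 2 * delta], i.e. [D + 2] units. *)
Fixpoint load (n D : nat) (cr : 'I_n -> nat -> bool) (sel : nat -> {set 'I_n})
    (t : nat) (j : 'I_n) : nat :=
  if t is t'.+1 then
    ((load D cr sel t' j + cr j t * D.+1) - (j \in sel t) * D.+2)%N
  else 0%N.

Definition poured_load (n D : nat) (cr : 'I_n -> nat -> bool)
    (sel : nat -> {set 'I_n}) (t : nat) (j : 'I_n) : nat :=
  (load D cr sel t j + cr j t.+1 * D.+1)%N.

Definition busy_cups (n D : nat) (cr : 'I_n -> nat -> bool)
    (sel : nat -> {set 'I_n}) (t : nat) : {set 'I_n} :=
  [set j | poured_load D cr sel t j != 0%N].

Definition full_step (n D p : nat) (cr : 'I_n -> nat -> bool)
    (sel : nat -> {set 'I_n}) (t : nat) : bool :=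
  (p < #|busy_cups D cr sel t|)%N.

(** All that the search for resets uses of the greedy rule. Index [t] denotes the state before step
    [t.+1], hence [sel t.+1]. *)
Definition work_conserving (n D p : nat) (cr : 'I_n -> nat -> bool)
    (sel : nat -> {set 'I_n}) : Prop := forall t,
  if full_step D p cr sel t
  then #|sel t.+1| = p.+1 /\ sel t.+1 \subset busy_cups D cr sel t
  else busy_cups D cr sel t \subset sel t.+1.

Section Busy.
Variables (n D p : nat) (cr : 'I_n -> nat -> bool) (sel : nat -> {set 'I_n}).
Hypothesis wc : work_conserving D p cr sel.

Local Notation W := (load D cr sel).
Local Notation full := (full_step D p cr sel).

(* The number of selections needed to empty the counter of cup [j]. *)
Let visits t j := ((W t j + D.+1) %/ D.+2)%N.

(** A crossing adds [D + 1] units, less than one visit can remove, so it costs at most one more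
    visit; selecting a busy cup saves exactly one. *)
Lemma visits_succ t j :
  (visits t.+1 j + (j \in sel t.+1) * (poured_load D cr sel t j != 0)
   <= visits t j + cr j t.+1)%N.
Proof.
rewrite /visits /poured_load /=.
set w := W t j; set x := cr j t.+1; set e := _ \in _.
have h1 : ((w + x * D.+1 + D.+1) %/ D.+2 <= (w + D.+1) %/ D.+2 + x)%N.
  rewrite addnC [X in (_ <= X)%N]addnC -(divnMDl x _ (ltn0Sn D.+1)).
  by apply: leq_div2r; case: x => /=; lia.
case: e => /=; last by rewrite subn0 addn0.
case: eqP => [e0|ne0] /=; first by rewrite e0 sub0n divn_small//.
apply: leq_trans h1.
have [lt|le] := ltnP (w + x * D.+1) D.+2.
  have -> : (w + x * D.+1 - 1 * D.+2 = 0)%N by lia.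
  by rewrite add0n divn_small// add0n divn_gt0//; lia.
have -> : (w + x * D.+1 + D.+1 = 1 * D.+2 + (w + x * D.+1 - 1 * D.+2 + D.+1))%N by lia.
by rewrite divnMDl// mul1n add1n addn1.
Qed.

Lemma total_visits_full t : full t ->
  (\sum_j visits t.+1 j + p.+1 <= \sum_j visits t j + \sum_j cr j t.+1)%N.
Proof.
move=> ft; have := wc t; rewrite ft => -[card_sel /fintype.subsetP sub].
rewrite -card_sel -sum1_card [X in (_ + X <= _)%N]big_mkcond -!big_split /=.
apply: leq_sum => j _; apply: leq_trans (visits_succ t j).
rewrite leq_add2l; case: ifP => // jsel.
by have := sub _ jsel; rewrite inE => ->.
Qed.

(** Every busy cup is selected, and the visit this saves pays for the one that a crossing may
    add. *)
Lemma total_visits_nonfull t : ~~ full t ->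
  (\sum_j visits t.+1 j <= \sum_j visits t j)%N.
Proof.
move=> /negbTE ft; have := wc t; rewrite ft => /fintype.subsetP sub.
apply: leq_sum => j _; have := visits_succ t j; have := sub j; rewrite !inE.
case: eqP => [w0 _ _|ne0 -> //=]; last by case: (cr j _) => /=; lia.
suff -> : visits t.+1 j = 0%N by [].
have : (W t.+1 j <= poured_load D cr sel t j)%N.
  by rewrite /poured_load /= leq_subr.
by rewrite w0 leqn0 /visits => /eqP ->; rewrite add0n divn_small.
Qed.

Lemma load_full t j : (W t.+1 j <= W t j + D.+1)%N.
Proof. by rewrite /=; case: (cr j _); case: (_ \in _); lia. Qed.

Lemma load_nonfull t j : ~~ full t -> (W t.+1 j <= (W t j).-1)%N.
Proof.
move=> /negbTE ft; have := wc t; rewrite ft => /fintype.subsetP /(_ j).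
rewrite inE /poured_load /=; case: eqP => [w0 _|_ -> //].
  by rewrite w0.
by case: (cr j _) => /=; lia.
Qed.

(** A load rises by at most [D + 1] in a full step and falls by one in any other, so load plus
    elapsed time stays below [D + 2] times the number of full steps. *)
Lemma full_steps_count t0 T : (forall j, W t0 j = 0%N) ->
  (forall t, (t < T)%N -> exists j, W (t0 + t).+1 j != 0%N) ->
  (T <= D.+2 * \sum_(t < T) full (t0 + t))%N.
Proof.
move=> W0.
suff H : (forall t, (t < T)%N -> exists j, W (t0 + t).+1 j != 0%N) ->
  (T <= D.+2 * \sum_(t < T) full (t0 + t) /\
   forall j, W (t0 + T) j + T <= D.+2 * \sum_(t < T) full (t0 + t))%N.
  by case/H.
elim: T => [_|T IH noreset].
  by split=> // j; rewrite !addn0 W0.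
have [|IH1 IH2] := IH; first by move=> t tT; apply: noreset; exact: ltnW.
rewrite big_ord_recr/= addnS.
suff K : (forall j, W (t0 + T).+1 j + T.+1
     <= D.+2 * (\sum_(i < T) full (t0 + i) + full (t0 + T)))%N.
  split=> //; have [j _] := noreset T (leqnn _); exact: leq_trans (leq_addl _ _) (K j).
(* If cup [j] is already empty its load cannot fall; the still nonempty cup [j0] bounds the elapsed
   time instead. *)
have [j0 j0P] := noreset T (leqnn _).
move=> j; case: (boolP (full (t0 + T))) => ft.
  have := load_full (t0 + T) j; have := IH2 j.
  move: (W (t0 + T).+1 j) => a; lia.
have := load_nonfull j ft; have := load_nonfull j0 ft.
have := IH2 j; have := IH2 j0; move: j0P.
move: (W (t0 + T).+1 j) (W (t0 + T).+1 j0) => a b; rewrite !addn0; lia.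
Qed.

(** The total of visits due starts at 0, cannot be negative, loses [p + 1] in each full step, and
    rises only through crossings in full steps. *)
Lemma full_steps_crossings t0 T : (forall j, W t0 j = 0%N) ->
  (p.+1 * \sum_(t < T) full (t0 + t) <=
   \sum_(t < T | full (t0 + t)) \sum_j cr j (t0 + t).+1)%N.
Proof.
move=> W0; apply: (@leq_trans (\sum_j visits (t0 + T) j +
    p.+1 * \sum_(t < T) full (t0 + t))%N); first exact: leq_addl.
rewrite [X in (_ <= X)%N]big_mkcond /=; elim: T => [|T IH].
  rewrite !big_ord0 muln0 !addn0 big1// => j _.
  by rewrite /visits W0 add0n divn_small.
rewrite !big_ord_recr/= addnS mulnDr.
case: (boolP (full (t0 + T))) => ft.
  apply: leq_trans (leq_add IH (leqnn _)).
  by rewrite muln1 [leqRHS]addnAC addnCA addnC leq_add2r total_visits_full.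
rewrite muln0 !addn0; apply: leq_trans IH.
by rewrite leq_add2r total_visits_nonfull.
Qed.

End Busy.

(** * Thresholds *)

Lemma block_startP (D i : nat) : (0 < D)%N ->
  reflect (exists m, i = (m * D.+1).+1) (block_start D i).
Proof.
move=> D0; apply: (iffP idP) => [/andP[i0 /eqP imod]|[m ->]].
  exists (i %/ D.+1)%N; rewrite {1}(divn_eq i D.+1) imod.
  by rewrite (@modn_small 1) ?addn1.
by rewrite /block_start /= -addn1 modnMDl eqxx.
Qed.

Section Thresholds.
Variables (R : realType) (D : nat) (sj : nat -> R).
Hypothesis D_gt0 : (0 < D)%N.
Hypothesis offset : forall i, block_start D i -> 0 < sj i <= 1.

(** Thresholds of one block share their offset and so differ by integers; between two blocks lies a
    unit cell without thresholds. *)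
Lemma threshold_gap (x y : R) :
  thresholds D sj x -> thresholds D sj y -> x < y -> x + 1 <= y.
Proof.
move=> [i [t [bi /andP[t1 tD] ->]]] [i' [t' [bi' /andP[t1' tD'] ->]]].
have /andP[si0 si1] := offset bi; have /andP[si0' si1'] := offset bi'.
have [m im] := (block_startP i D_gt0 bi).
have [m' im'] := (block_startP i' D_gt0 bi').
have [mm'|mm'|mm'] := ltngtP m m'.
- have : ((i + t).+2 <= i' + t')%N.
    have : (m.+1 * D.+1 <= m' * D.+1)%N by rewrite leq_mul2r mm' orbT.
    by rewrite im im'; lia.
  by rewrite -(ler_nat R) -addn2 natrD => ?; lra.
- have : ((i' + t').+2 <= i + t)%N.
    have : (m'.+1 * D.+1 <= m * D.+1)%N by rewrite leq_mul2r mm' orbT.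
    by rewrite im im'; lia.
  by rewrite -(ler_nat R) -addn2 natrD => ? ?; lra.
- have <- : i = i' by rewrite im im' mm'.
  rewrite ltrD2r ltr_nat -addnS addnC => tt'.
  by rewrite addrAC lerD2r natr1 ler_nat -addnS addnC.
Qed.

(** Enumerates the thresholds in increasing order from 0: block [q %/ D], position [q %% D] within
    it. *)
Definition nth_threshold (q : nat) : R :=
  ((q %/ D * D.+1).+1 + (q %% D).+1)%:R + sj (q %/ D * D.+1).+1.

Lemma nth_thresholdP q : thresholds D sj (nth_threshold q).
Proof.
exists (q %/ D * D.+1).+1, (q %% D).+1; split=> //.
  by apply/(block_startP _ D_gt0); exists (q %/ D)%N.
by rewrite /= ltn_mod.
Qed.

Lemma nth_threshold_gap q : nth_threshold q + 1 <= nth_threshold q.+1.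
Proof.
apply: threshold_gap; [exact: nth_thresholdP..|].
rewrite /nth_threshold divnS// modnS; case: ifPn => [Dq|Dq]; last first.
  by rewrite add0n ltrD2r ltr_nat; lia.
have h m : block_start D (m * D.+1).+1.
  by apply/(block_startP _ D_gt0); exists m.
have /andP[_ s1] := offset (h (q %/ D)%N).
have /andP[s0 _] := offset (h (1 + q %/ D)%N).
suff : (((q %/ D * D.+1).+1 + (q %% D).+1).+1 <= ((1 + q %/ D) * D.+1).+1 + 1)%N.
  by rewrite -(ler_nat R) -natr1 /= => ?; lra.
by have := ltn_pmod q D_gt0; rewrite mulnDl; lia.
Qed.

(** A block has [D] thresholds on length [D + 1], whence the slope. The 3 collects the offset and
    the numbering of blocks and positions from 1. *)
Lemma nth_threshold_le q : nth_threshold q <= 3 + (1 + D%:R^-1) * q%:R.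
Proof.
have /andP[_ s1] : 0 < sj (q %/ D * D.+1).+1 <= 1.
  by apply: offset; apply/(block_startP _ D_gt0); exists (q %/ D)%N.
have D0 : (0 : R) < D%:R by rewrite ltr0n.
rewrite /nth_threshold [X in _ * X%:R](divn_eq q D) !natrD !natrM -!natr1 natrM -!natr1.
move: (q %/ D)%N (q %% D)%N s1 => a b s1.
have -> : (1 + D%:R^-1 : R) * (a%:R * D%:R + b%:R) =
  a%:R * (D%:R + 1) + b%:R + b%:R / D%:R by field; rewrite gt_eqF.
have : (0 : R) <= b%:R / D%:R by rewrite divr_ge0.
by lra.
Qed.

End Thresholds.

(** * Crossings, counters and fills along a run *)

Section Run.
Variables (R : realType) (n D : nat) (c : nat -> 'I_n -> R).
Variables (s : 'I_n -> nat -> R).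
Hypothesis D_gt0 : (0 < D)%N.
Hypothesis offset : forall j i, block_start D i -> 0 < s j i <= 1.
Hypothesis pour01 : forall i j, (0 < i)%N -> 0 <= c i j <= 1.

Lemma poured_totalS j i :
  poured_total c j i.+1 = poured_total c j i + c i.+1 j.
Proof. by rewrite /poured_total big_nat_recr. Qed.

Definition crosses (j : 'I_n) (i : nat) : bool := `[< crossed D c s j i !=set0 >].

(** Thresholds are at least 1 apart and a step pours at most 1, so the half-open poured interval
    contains at most one. *)
Lemma crossed_sum j i (x : R) : (0 < i)%N ->
  \sum_(y \in crossed D c s j i) x = x * (crosses j i)%:R.
Proof.
case: i => // i _; rewrite /crosses; case: asboolP => [[y [ty yc]]|no]; last first.
  suff -> : crossed D c s j i.+1 = set0 by rewrite fsbig_set0 mulr0.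
  by apply/seteqP; split=> // y yc; case: no; exists y.
suff -> : crossed D c s j i.+1 = [set y] by rewrite fsbig_set1 mulr1.
apply/seteqP; split=> [z [tz zc]|_ ->] //.
move: yc zc; rewrite /= poured_totalS; have /andP[_] := pour01 j (ltn0Sn i).
move=> c1 /andP[y1 y2] /andP[z1 z2].
have [zy|yz|//] := ltgtP z y.
  by have := threshold_gap D_gt0 (@offset j) tz ty zy; lra.
by have := threshold_gap D_gt0 (@offset j) ty tz yz; lra.
Qed.

Definition crossings (j : 'I_n) (i : nat) : nat := \sum_(t < i) crosses j t.+1.

(** Invariant: the threshold of index [crossings j i] is not yet reached. A step reaching it raises
    the count, and the next threshold is at least 1 further. *)
Lemma poured_total_lt j i :
  poured_total c j i < nth_threshold D (s j) (crossings j i).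
Proof.
have mono q q' : (q <= q')%N -> nth_threshold D (s j) q <= nth_threshold D (s j) q'.
  elim: q' => [|q' IH]; first by rewrite leqn0 => /eqP ->.
  rewrite leq_eqVlt ltnS => /orP[/eqP -> //|/IH le].
  by apply: le_trans le _; have := nth_threshold_gap D_gt0 (@offset j) q'; lra.
elim: i => [|i IH].
  rewrite /poured_total big_geq// /nth_threshold.
  have /andP[s0 _] : 0 < s j (crossings j 0 %/ D * D.+1).+1 <= 1.
    by apply: offset; apply/(block_startP _ D_gt0); exists (crossings j 0 %/ D)%N.
  by rewrite ltr_wpDl.
rewrite poured_totalS /crossings big_ord_recr /= -/(crossings j i).
have /andP[c0 c1] := pour01 j (ltn0Sn i).
have [lt|ge] := ltP (poured_total c j i + c i.+1 j) (nth_threshold D (s j) (crossings j i)).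
  by apply: lt_le_trans lt (mono _ _ (leq_addr _ _)).
have -> : crosses j i.+1.
  apply/asboolP; exists (nth_threshold D (s j) (crossings j i)).
  by split; [exact: nth_thresholdP|rewrite /= poured_totalS IH].
by rewrite addn1; have := nth_threshold_gap D_gt0 (@offset j) (crossings j i); lra.
Qed.

Lemma poured_total_le j i :
  poured_total c j i <= 3 + (1 + D%:R^-1) * (crossings j i)%:R.
Proof.
exact: le_trans (ltW (poured_total_lt j i)) (nth_threshold_le D_gt0 (@offset j) _).
Qed.

Variable sel : nat -> {set 'I_n}.
Local Notation W := (load D crosses sel).

(** In units of [1 / D], the minimum in the removal rule becomes truncated subtraction of
    [D + 2]. *)
Lemma counter_run i j :
  counter (run D D%:R^-1 c s sel i) j = D%:R^-1 * (W i j)%:R.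
Proof.
have D0 : (0 : R) < D%:R by rewrite ltr0n.
elim: i j => [|i IH] j /=; first by rewrite mulr0.
rewrite IH crossed_sum//.
have -> : D%:R^-1 * (W i j)%:R + (1 + D%:R^-1) * (crosses j i.+1)%:R =
    D%:R^-1 * (W i j + crosses j i.+1 * D.+1)%:R :> R.
  by rewrite natrD natrM -natr1; field; rewrite gt_eqF.
have -> : 1 + 2 * D%:R^-1 = D%:R^-1 * D.+2%:R :> R.
  by rewrite -addn2 natrD; field; rewrite gt_eqF.
case: (_ \in _); last by rewrite subr0 subn0.
rewrite mul1n -minr_pMr ?invr_ge0// -mulrBr; congr (_ * _).
set w := (_ + _)%N; have [le|lt] := leP (D.+2%:R : R) w%:R.
  by rewrite natrB// -(ler_nat R).
have : (w <= D.+2)%N by rewrite -(ler_nat R) ltW.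
by rewrite -subn_eq0 => /eqP ->; rewrite subrr.
Qed.

(** Emptying lowers fill and counter by the same amount, so their difference does not depend on the
    selections. *)
Lemma fill_run i j : fill (run D D%:R^-1 c s sel i) j =
  poured_total c j i - (1 + D%:R^-1) * (crossings j i)%:R + D%:R^-1 * (W i j)%:R.
Proof.
rewrite -counter_run; elim: i => [|i IH] /=.
  by rewrite /poured_total big_geq// /crossings big_ord0 mulr0 subr0 addr0.
rewrite IH crossed_sum// poured_totalS /crossings big_ord_recr /= natrD.
by ring.
Qed.

Lemma fill_run_le i j : fill (run D D%:R^-1 c s sel i) j <=
  3 + counter (run D D%:R^-1 c s sel i) j.
Proof. by rewrite fill_run counter_run; have := poured_total_le j i; lra. Qed.

Lemma counter_poured i j :
  counter (pour_step D D%:R^-1 c s i.+1 (run D D%:R^-1 c s sel i)) j =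
  D%:R^-1 * (poured_load D crosses sel i j)%:R.
Proof.
have D0 : (0 : R) < D%:R by rewrite ltr0n.
rewrite /= counter_run crossed_sum// /poured_load natrD natrM -natr1.
by field; rewrite gt_eqF.
Qed.

Lemma priority_eq0 i j :
  (priority D%:R^-1 (D%:R^-1 * (poured_load D crosses sel i j)%:R : R) == 0%N) =
  (poured_load D crosses sel i j == 0%N).
Proof.
have D0 : (0 : R) < D%:R by rewrite ltr0n.
rewrite /priority mulf_eq0 invr_eq0 !pnatr_eq0 [D == 0%N]eqn0Ngt D_gt0 /=.
case: (eqVneq (poured_load D crosses sel i j) 0%N) => [->|_]; last by case: ifP.
by rewrite mulr0 ifF//; apply/negbTE; rewrite -ltNge ltr_wpDr ?invr_ge0// .
Qed.

(** A selected idle cup has the lowest priority, which forces all busy cups to be selected as well;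
    counting against [p + 1] settles both cases. *)
Lemma greedy_work_conserving p :
  smoothed_greedy p D D%:R^-1 c s sel -> work_conserving D p crosses sel.
Proof.
move=> greedy i; have [card_le few prio] := greedy i.
have D0 : (0 : R) < D%:R by rewrite ltr0n.
have busyE j : (j \in busy_cups D crosses sel i) =
    (priority D%:R^-1 (counter (pour_step D D%:R^-1 c s i.+1
       (run D D%:R^-1 c s sel i)) j) != 0%N).
  by rewrite inE counter_poured priority_eq0.
have few' : (#|sel i.+1| < p.+1)%N -> busy_cups D crosses sel i \subset sel i.+1.
  move=> lt; apply/fintype.subsetP => j; rewrite busyE => h; apply: few => //.
  rewrite counter_poured; move: h; rewrite counter_poured priority_eq0 => h.
  by rewrite mulf_eq0 invr_eq0 !pnatr_eq0 [D == 0%N]eqn0Ngt D_gt0.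
have idle j : j \in sel i.+1 -> j \notin busy_cups D crosses sel i ->
    busy_cups D crosses sel i \subset sel i.+1 :\ j.
  move=> jsel; rewrite busyE negbK => /eqP j0; apply/fintype.subsetP => l lb.
  have lj : l != j by apply: contraTneq lb => ->; rewrite busyE j0.
  rewrite !inE lj /=; apply: contraTT lb => lsel.
  by rewrite busyE negbK -leqn0 -j0; case: (prio j l jsel lsel).
rewrite /full_step; case: ltnP => [lt|le].
  have cardE : #|sel i.+1| = p.+1.
    apply/eqP; rewrite eqn_leq card_le /= leqNgt; apply/negP => lt2.
    by have := subset_leq_card (few' lt2); rewrite leqNgt (leq_trans lt2 lt).
  split=> //; apply/fintype.subsetP => j jsel; apply/negPn/negP => /(idle _ jsel).
  move=> /subset_leq_card; have := cardsD1 j (sel i.+1).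
  by rewrite jsel cardE; lia.
have [/few' //|ge] := ltnP #|sel i.+1| p.+1.
have /fintype.subsetPn[j jsel jb] : ~~ (sel i.+1 \subset busy_cups D crosses sel i).
  by apply/negP => /subset_leq_card; rewrite leqNgt (leq_ltn_trans le ge).
exact: fintype.subset_trans (idle _ jsel jb) (subsetDl _ _).
Qed.

End Run.

(** * Greedy emptying in the absence of randomness *)

Section Potential.
Variables (R : realType) (n p : nat) (eps K : R).
Hypothesis eps01 : 0 < eps <= 1.
Variables (f c f' : 'I_n -> R) (A : {set 'I_n}).
Hypothesis c01 : forall j, 0 <= c j <= 1.
Hypothesis sum_c : \sum_j c j <= (1 - eps) * p%:R.
Hypothesis f'_le : forall j, f' j <= f j + c j.
Hypothesis f'_sel : forall j, j \in A -> K < f j + c j -> f' j <= f j + c j - 1.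
Hypothesis cardA : #|A| = p.+1 \/ forall l, K < f l + c l -> l \in A.
Hypothesis fullest : forall j l, j \in A -> l \notin A -> K < f l + c l ->
  f l + c l <= f j + c j.

Let e (x : R) : R := expR (eps * Num.max x K).

Let e_le x y : Num.max x K <= Num.max y K -> e x <= e y.
Proof. by move=> xy; rewrite /e ler_expR ler_wpM2l//; case/andP: eps01 => /ltW. Qed.

Let e_low j : f j + c j <= K -> e (f' j) <= e (f j).
Proof.
move=> le; apply: e_le; rewrite ge_max !le_max lexx orbT andbT.
by rewrite (le_trans (f'_le j) le) orbT.
Qed.

Let e_sel j : j \in A -> e (f' j) <= e (f j).
Proof.
move=> jA; have [/e_low//|high] := leP (f j + c j) K.
apply: e_le; rewrite ge_max !le_max lexx orbT andbT; apply/orP; left.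
by have := f'_sel jA high; have /andP[] := c01 j; lra.
Qed.

(** If all unselected cups are at most [K], no term grows. Otherwise let [m] be the highest
    unselected level: the unselected cups gain at most [eps * expR (eps * m)] per unit of water,
    while [p + 1] selected cups at level at least [m] each lose a unit. *)
Lemma potential_step :
  \sum_j expR (eps * Num.max (f' j) K) <=
  \sum_j expR (eps * Num.max (f j) K) + p%:R * expR (eps * (K + 1)).
Proof.
have /andP[eps0 eps1] := eps01; rewrite -/e.
have add_ge0 : 0 <= p%:R * expR (eps * (K + 1)) by rewrite mulr_ge0// expR_ge0.
have [l0 /andP[l0A l0high]|nohigh] := pickP [pred l | (l \notin A) && (K < f l + c l)]; last first.
  apply: (@le_trans _ _ (\sum_j e (f j))); last by rewrite lerDl.
  apply: ler_sum => j _; have [/e_sel//|jA] := boolP (j \in A).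
  by apply: e_low; have := nohigh j; rewrite /= jA/= => /negbT; rewrite -leNgt.
pose l := [arg max_(l > l0 | l \notin A) (f l + c l)]%O.
have [lA lmax] : l \notin A /\ forall k, k \notin A -> f k + c k <= f l + c l.
  by rewrite /l; case: arg_maxP.
set m := f l + c l in lmax.
have mK : K < m by apply: lt_le_trans l0high (lmax _ l0A).
have cardAE : #|A| = p.+1 by case: cardA => // /(_ l0 l0high); rewrite (negbTE l0A).
have out j : j \notin A -> e (f' j) - e (f j) <= eps * c j * expR (eps * m).
  move=> jA; have /andP[c0 c1] := c01 j.
  have [/e_low low|high] := leP (f j + c j) K.
    by apply: (@le_trans _ _ 0); [rewrite subr_le0|rewrite !mulr_ge0 ?expR_ge0// ltW].
  have h1 : e (f' j) <= expR (eps * (f j + c j)).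
    rewrite ler_expR ler_wpM2l ?(ltW eps0)// ge_max (ltW high) andbT; exact: f'_le.
  have h2 : expR (eps * (f j + c j)) * (1 - eps * c j) <= e (f j).
    apply: (@le_trans _ _ (expR (eps * (f j + c j)) * expR (- (eps * c j)))).
      by rewrite ler_wpM2l ?expR_ge0// expR_ge1Dx.
    rewrite -expRD ler_expR -mulrN -mulrDr addrK ler_wpM2l ?(ltW eps0)//.
    by rewrite le_max lexx.
  apply: (@le_trans _ _ (eps * c j * expR (eps * (f j + c j)))); first by lra.
  by rewrite ler_wpM2l ?mulr_ge0 ?(ltW eps0)// ler_expR ler_wpM2l ?(ltW eps0)// lmax.
have split_sum (F : 'I_n -> R) :
    \sum_j F j = \sum_(j in A) F j + \sum_(j | j \notin A) F j.
  by rewrite (bigID (mem A)).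
set CA := \sum_(j in A) c j; set CN := \sum_(j | j \notin A) c j.
have sumC : CA + CN <= (1 - eps) * p%:R by rewrite -split_sum.
have CA0 : 0 <= CA by apply: sumr_ge0 => j _; case/andP: (c01 j).
have CN0 : 0 <= CN by apply: sumr_ge0 => j _; case/andP: (c01 j).
have outs : \sum_(j | j \notin A) (e (f' j) - e (f j)) <= eps * CN * expR (eps * m).
  by rewrite mulr_sumr mulr_suml; apply: ler_sum => j /out; rewrite mulrAC.
rewrite -lerBlDl -sumrB split_sum.
(* Near the truncation level the selected cups may lose less than needed, but there the gain itself
   fits into the error term. *)
have [mK1|mK1] := ltP m (K + 1).
  apply: (@le_trans _ _ (eps * CN * expR (eps * m))).
    rewrite -[leRHS]add0r lerD//; apply: sumr_le0 => j jA.
    by rewrite subr_le0 e_sel.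
  apply: ler_pM; rewrite ?expR_ge0 ?mulr_ge0 ?(ltW eps0)//.
    have : eps * CN <= CN by rewrite ler_piMl.
    have : (1 - eps) * p%:R <= p%:R by rewrite ler_piMl// lerBlDr lerDl ltW.
    by lra.
  by rewrite ler_expR ler_wpM2l ?(ltW eps0)// ltW.
set y := expR (eps * m) in outs *; have y0 : 0 < y by exact: expR_gt0.
set z := expR (- eps).
have z1 : z <= 1 by rewrite -expR0 ler_expR oppr_le0 ltW.
have z0 : 1 - eps <= z by exact: expR_ge1Dx.
have zpos : 0 < z by exact: expR_gt0.
have sels : \sum_(j in A) (e (f' j) - e (f j)) <= - (eps * y * z * (p.+1%:R - CA)).
  have -> : p.+1%:R - CA = \sum_(j in A) (1 - c j).
    by rewrite sumrB sumr_const cardAE.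
  rewrite mulr_sumr -sumrN; apply: ler_sum => j jA.
  have /andP[c0 c1] := c01 j.
  have mj : m <= f j + c j by apply: fullest.
  have h1 : e (f' j) <= expR (eps * (f j + c j - 1)).
    rewrite ler_expR ler_wpM2l ?(ltW eps0)// ge_max; apply/andP; split; last by lra.
    by apply: f'_sel => //; apply: lt_le_trans mj.
  have h2 : expR (eps * (f j + c j - 1)) * (1 + eps * (1 - c j)) <= e (f j).
    apply: (@le_trans _ _ (expR (eps * (f j + c j - 1)) * expR (eps * (1 - c j)))).
      by rewrite ler_wpM2l ?expR_ge0// expR_ge1Dx.
    rewrite -expRD ler_expR -mulrDr ler_wpM2l ?(ltW eps0)// le_max.
    by apply/orP; left; lra.
  have h3 : y * z <= expR (eps * (f j + c j - 1)).
    rewrite -expRD ler_expR -[X in _ + X]mulr1 mulNr -mulrBr ler_wpM2l ?(ltW eps0)//.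
    by rewrite lerD2r.
  have h4 : y * z * (eps * (1 - c j)) <= expR (eps * (f j + c j - 1)) * (eps * (1 - c j)).
    by rewrite ler_wpM2r// mulr_ge0 ?subr_ge0 ?(ltW eps0).
  lra.
(* The net change is nonpositive because [CA + CN <= (1 - eps) * p <= z * p]. *)
apply: le_trans add_ge0; apply: le_trans (lerD sels outs) _.
rewrite -/y (_ : _ + _ = eps * y * (CN - z * (p.+1%:R - CA))); last by ring.
apply: mulr_ge0_le0; first by rewrite mulr_ge0 ?(ltW eps0) ?(ltW y0).
have : CA * z <= CA by rewrite ler_piMr.
have : (1 - eps) * p%:R <= z * p%:R by rewrite ler_wpM2r.
rewrite -natr1; lra.
Qed.

End Potential.

(** * Growth of the potential along a run *)

Section Greedy.
Variables (R : realType) (n p D : nat) (eps : R) (c : nat -> 'I_n -> R).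
Variables (s : 'I_n -> nat -> R) (sel : nat -> {set 'I_n}).
Hypothesis D_gt0 : (0 < D)%N.
Hypothesis eps01 : 0 < eps <= 1.
Hypothesis offset : forall j i, block_start D i -> 0 < s j i <= 1.
Hypothesis filler : oblivious_filler p eps c.
Hypothesis greedy : smoothed_greedy p D D%:R^-1 c s sel.

Local Notation state_at := (run D D%:R^-1 c s sel).
Local Notation W := (load D (crosses D c s) sel).

Let pour01 i j : (0 < i)%N -> 0 <= c i j <= 1.
Proof. by move=> /filler[]. Qed.

Let Phi i : R := \sum_j expR (eps * Num.max (fill (state_at i) j) 5).

(** Level 5 works because a fill above 5 forces a counter above 2, hence at least [1 + delta]: top
    priority, and at least one unit is removed. *)
Lemma run_potential_step i : Phi i.+1 <= Phi i + p%:R * expR (eps * (5 + 1)).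
Proof.
have D0 : (0 : R) < D%:R by rewrite ltr0n.
have D1 : D%:R^-1 <= 1 :> R by rewrite invf_le1// ler1n.
have d0 : 0 <= D%:R^-1 :> R by rewrite invr_ge0 ltW.
set u := pour_step D D%:R^-1 c s i.+1 (state_at i).
have [card_le few prio] := greedy i; rewrite -/u in few prio.
have ctr0 j : 0 <= counter u j.
  by rewrite (@counter_poured _ _ _ _ _ D_gt0 offset pour01) mulr_ge0.
(* Emptying preserves fill minus counter, so the bound known after the step transfers to the poured
   state. *)
have ctr j : fill u j - 3 <= counter u j.
  have := @fill_run_le _ _ _ _ _ D_gt0 offset pour01 sel i.+1 j.
  rewrite -[state_at i.+1]/(empty_step D%:R^-1 (sel i.+1) u).
  by move: (u) => v /=; lra.
have high2 j : 5 < fill u j -> priority D%:R^-1 (counter u j) = 2%N.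
  by move=> h; rewrite /priority ifT//; have := ctr j; lra.
have [c01 sumc] := filler (ltn0Sn i).
apply: (@potential_step _ _ p eps 5 eps01 _ (c i.+1) _ (sel i.+1)) => //.
- move=> j /=; rewrite lerBlDr lerDl; case: ifP => // _.
  by rewrite le_min ctr0 andbT; lra.
- move=> j jA high; rewrite /= jA lerD2l lerN2 le_min.
  apply/andP; split; first by lra.
  by apply: le_trans (ctr j); rewrite [fill u j]/=; move: high; lra.
- have [lt|ge] := ltnP #|sel i.+1| p.+1; last first.
    by left; apply/eqP; rewrite eqn_leq card_le.
  right=> l high; apply: few => //; apply/eqP => ctr_eq0.
  by have := ctr l; rewrite ctr_eq0 [fill u l]/=; move: high; lra.
- move=> j l jA lA high; have [p1 p2] := prio j l jA lA.
  apply: p2; apply/eqP; rewrite eqn_leq p1 (high2 l)// /priority.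
  by case: ifP => // _; case: ifP.
Qed.

(** At a reset all fills are at most 3, so [Phi] has its least value [n * expR (eps * 5)]. The other
    cups always contribute at least their share of it, so [n] cancels. *)
Lemma fill_after_reset t0 T j : (forall l, W t0 l = 0%N) ->
  expR (eps * fill (state_at (t0 + T)) j) <= expR (eps * 6) * (T%:R * p%:R + 1).
Proof.
move=> W0; have /andP[eps0 _] := eps01.
have : Phi (t0 + T) <= n%:R * expR (eps * 5) + T%:R * (p%:R * expR (eps * (5 + 1))).
  elim: T => [|T IH].
    rewrite addn0 mul0r addr0 /Phi; have fle l : fill (state_at t0) l <= 5.
      have := @fill_run_le _ _ _ _ _ D_gt0 offset pour01 sel t0 l.
      by rewrite (@counter_run _ _ _ _ _ D_gt0 offset pour01) W0 mulr0; lra.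
    under eq_bigr do rewrite max_r//.
    by rewrite sumr_const card_ord mulr_natl.
  rewrite addnS; apply: le_trans (run_potential_step _) _.
  by rewrite -[T.+1%:R]natr1 mulrDl mul1r addrA lerD2r.
have : expR (eps * Num.max (fill (state_at (t0 + T)) j) 5) - expR (eps * 5) <=
    Phi (t0 + T) - n%:R * expR (eps * 5).
  have -> : n%:R * expR (eps * 5) = \sum_(l < n) expR (eps * 5).
    by rewrite sumr_const card_ord mulr_natl.
  rewrite -sumrB (bigD1 j)//= lerDl; apply: sumr_ge0 => l _.
  by rewrite subr_ge0 ler_expR ler_wpM2l ?(ltW eps0)// le_max lexx orbT.
have : expR (eps * fill (state_at (t0 + T)) j) <=
    expR (eps * Num.max (fill (state_at (t0 + T)) j) 5).
  by rewrite ler_expR ler_wpM2l ?(ltW eps0)// le_max lexx.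
have : expR (eps * 5) <= expR (eps * 6) by rewrite ler_expR ler_wpM2l ?(ltW eps0)//; lra.
rewrite (_ : 5 + 1 = 6); last by lra.
lra.
Qed.

End Greedy.

(** * Functions of independent variables with finitely many values *)

(** From [1 - y <= expR (- y)], [expR y] is at most [1 / (1 - y)], which the quadratic dominates up
    to [1 / 2]. *)
Lemma expR_le_quadratic (R : realType) (y : R) : y <= 1 / 2 ->
  expR y <= 1 + y + 2 * y ^+ 2.
Proof.
move=> y2; have h := expR_ge1Dx (- y).
have e0 := expR_gt0 y; have e1 : expR y * expR (- y) = 1 by rewrite expRN divff// gt_eqF.
have : expR y * (1 - y) <= 1 by rewrite -[leRHS]e1 ler_wpM2l// ltW.
have : 0 <= y ^+ 2 * (1 - 2 * y) by rewrite mulr_ge0 ?sqr_ge0//; lra.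
have : (1 + y + 2 * y ^+ 2) * (1 - y) = 1 + y ^+ 2 * (1 - 2 * y) by ring.
move=> e2 e3 e4; rewrite -(@ler_pM2r _ (1 - y)); last by lra.
by rewrite e2; lra.
Qed.

Section OneVariable.
Variables (R : realType) (V : finType) (q : V -> R).
Hypothesis q_ge0 : forall v, 0 <= q v.
Hypothesis q_sum1 : \sum_v q v = 1.
Variables (x u : V -> R) (d theta : R).
Hypothesis u_ge0 : forall v, 0 <= u v.
Hypothesis u_le : forall v, q v != 0 -> u v <= d.
Hypothesis x_lip : forall v v', `|x v - x v'| <= u v + u v'.
Hypothesis theta_ge0 : 0 <= theta.
Hypothesis theta_d : 4 * theta * d <= 1.

(** The deviation from the mean is at most [u v + ub <= 2 * d], so its square is at most
    [2 * d * (u v + ub)]: the variance is controlled by the mean of [u], not by [d ^+ 2]. *)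
Lemma mgf_one_variable : \sum_v q v * expR (theta * x v) <=
  expR (theta * (\sum_v q v * x v) + 8 * theta ^+ 2 * d * \sum_v q v * u v).
Proof.
set mu := \sum_v q v * x v; set ub := \sum_v q v * u v.
have ub0 : 0 <= ub by apply: sumr_ge0 => v _; rewrite mulr_ge0.
have ubd : ub <= d.
  rewrite -[leRHS]mul1r -q_sum1 mulr_suml; apply: ler_sum => v _.
  have [->|/u_le le] := eqVneq (q v) 0; first by rewrite !mul0r.
  by rewrite ler_wpM2l.
have dev v : `|x v - mu| <= u v + ub.
  have -> : x v - mu = \sum_v' q v' * (x v - x v').
    by under eq_bigr do rewrite mulrBr; rewrite sumrB -mulr_suml q_sum1 mul1r.
  have -> : u v + ub = \sum_v' q v' * (u v + u v').
    by under eq_bigr do rewrite mulrDr; rewrite big_split /= -mulr_suml q_sum1 mul1r.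
  apply: le_trans (ler_norm_sum _ _ _) _; apply: ler_sum => v' _.
  by rewrite normrM ger0_norm// ler_wpM2l.
have d0 : 0 <= d by exact: le_trans ub0 ubd.
have term v : q v * expR (theta * (x v - mu)) <=
    q v * (1 + theta * (x v - mu) + 4 * theta ^+ 2 * d * (u v + ub)).
  have [->|qv] := eqVneq (q v) 0; first by rewrite !mul0r.
  rewrite ler_wpM2l//; have ud := u_le qv; have dv := dev v.
  set y := x v - mu in dv *; set U := u v + ub in dv *.
  have Ud : U <= 2 * d by rewrite /U; lra.
  have ty : theta * y <= 1 / 2.
    have : theta * y <= theta * (2 * d).
      by rewrite ler_wpM2l// (le_trans (ler_norm _))// (le_trans dv).
    by move: theta_d; lra.
  apply: le_trans (expR_le_quadratic ty) _; rewrite lerD2l exprMn.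
  have y2 : y ^+ 2 <= 2 * d * U.
    rewrite -real_normK ?num_real// expr2.
    by apply: ler_pM => //; exact: le_trans dv Ud.
  have : theta ^+ 2 * y ^+ 2 <= theta ^+ 2 * (2 * d * U) by rewrite ler_wpM2l ?sqr_ge0.
  by lra.
have -> : \sum_v q v * expR (theta * x v) =
    expR (theta * mu) * \sum_v q v * expR (theta * (x v - mu)).
  rewrite mulr_sumr; apply: eq_bigr => v _; rewrite mulrCA -expRD.
  by congr (_ * expR _); ring.
rewrite expRD ler_wpM2l ?expR_ge0//; apply: le_trans (expR_ge1Dx _).
apply: le_trans (ler_sum _ (fun v _ => term v)) _.
rewrite [leLHS](_ : _ = \sum_v (q v + theta * (q v * x v) - theta * (q v * mu) +
  4 * theta ^+ 2 * d * (q v * u v) + 4 * theta ^+ 2 * d * (q v * ub))); last first.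
  by apply: eq_bigr => v _; ring.
rewrite !big_split /= sumrN -!mulr_sumr -!mulr_suml -/mu -/ub.
by rewrite q_sum1 le_eqVlt; apply/orP; left; apply/eqP; ring.
Qed.

End OneVariable.

(** * Finite product distributions and Bernstein's inequality *)

Section Expectation.
Variables (R : realType) (I V : finType) (q : I -> V -> R).

Definition weight (f : {ffun I -> V}) : R := \prod_i q i (f i).

Definition expect (F : {ffun I -> V} -> R) : R := \sum_f weight f * F f.

Lemma expect_prod (G : I -> V -> R) :
  expect (fun f => \prod_i G i (f i)) = \prod_i \sum_v q i v * G i v.
Proof. by rewrite bigA_distr_bigA; apply: eq_bigr => f _; rewrite -big_split. Qed.

Lemma expect_sum (J : finType) (P : pred J) (F : J -> {ffun I -> V} -> R) :
  expect (fun f => \sum_(t | P t) F t f) = \sum_(t | P t) expect (F t).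
Proof.
by rewrite exchange_big; apply: eq_bigr => f _; rewrite mulr_sumr.
Qed.

Lemma expectZ (a : R) (F : {ffun I -> V} -> R) :
  expect (fun f => a * F f) = a * expect F.
Proof. by rewrite mulr_sumr; apply: eq_bigr => f _; rewrite mulrCA. Qed.

Hypothesis q_ge0 : forall i v, 0 <= q i v.

Lemma weight_ge0 f : 0 <= weight f.
Proof. by apply: prodr_ge0 => i _. Qed.

Lemma expect_le (F G : {ffun I -> V} -> R) :
  (forall f, F f <= G f) -> expect F <= expect G.
Proof. by move=> FG; apply: ler_sum => f _; rewrite ler_wpM2l// weight_ge0. Qed.

Lemma markov_exp (F : {ffun I -> V} -> R) (theta lambda : R) : 0 <= theta ->
  expect (fun f => (lambda <= F f)%R%:R) <=
  expR (- (theta * lambda)) * expect (fun f => expR (theta * F f)).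
Proof.
move=> t0; rewrite -expectZ; apply: expect_le => f; rewrite -expRD.
case: (leP lambda (F f)) => [le|_]; last exact: expR_ge0.
rewrite -[leLHS]expR0 ler_expR addrC subr_ge0; exact: ler_wpM2l.
Qed.

Hypothesis q_sum1 : forall i, \sum_v q i v = 1.

Lemma expect_cst (a : R) : expect (fun=> a) = a.
Proof.
rewrite /expect -mulr_suml (_ : \sum_f _ = 1) ?mul1r//.
by rewrite -bigA_distr_bigA big1.
Qed.

Definition update (i : I) (v : V) (f : {ffun I -> V}) : {ffun I -> V} :=
  [ffun k => if k == i then v else f k].

Lemma update_same i v v' f : update i v (update i v' f) = update i v f.
Proof. by apply/ffunP => k; rewrite !ffunE; case: eqP. Qed.

Lemma update_comm i k v v' f : i != k ->
  update i v (update k v' f) = update k v' (update i v f).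
Proof.
move=> ik; apply/ffunP => l; rewrite !ffunE; case: (eqVneq l i) => // ->.
by rewrite (negbTE ik).
Qed.

Lemma update_id i (f : {ffun I -> V}) : update i (f i) f = f.
Proof. by apply/ffunP => k; rewrite !ffunE; case: eqP => // ->. Qed.

(** The conditional expectation given all coordinates other than [i]. *)
Definition average (i : I) (F : {ffun I -> V} -> R) (f : {ffun I -> V}) : R :=
  \sum_v q i v * F (update i v f).

Lemma weight_update i v (f : {ffun I -> V}) : weight (update i v f) * q i (f i) = weight f * q i v.
Proof.
rewrite /weight (bigD1 i)//= ffunE eqxx [in RHS](bigD1 i)//=.
rewrite (eq_bigr (fun k => q k (f k))); last by move=> k ki; rewrite ffunE (negbTE ki).
by ring.
Qed.

(** Exchanging the resampled value with the current one is an involution that preserves the joint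
    weight. *)
Lemma expect_average i F : expect (average i F) = expect F.
Proof.
rewrite /expect; under eq_bigr do rewrite mulr_sumr.
rewrite pair_big /=.
rewrite (reindex_inj (h := fun fv => (update i fv.2 fv.1, fv.1 i))) /=; last first.
  apply: (can_inj (g := fun fv => (update i fv.2 fv.1, fv.1 i))) => -[f v] /=.
  by rewrite update_same update_id ffunE eqxx.
under eq_bigr => fv _ do rewrite update_same update_id mulrA weight_update.
rewrite -(pair_bigA _ (fun f v => weight f * q i v * F f)) /=.
apply: eq_bigr => f _; under eq_bigr do rewrite mulrAC.
by rewrite -mulr_sumr q_sum1 mulr1.
Qed.

Fixpoint averages (l : seq I) (F : {ffun I -> V} -> R) : {ffun I -> V} -> R :=
  if l is i :: l' then averages l' (average i F) else F.

Let indep i (F : {ffun I -> V} -> R) := forall f v, F (update i v f) = F f.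

Let indep_average i k F : indep i F -> indep i (average k F).
Proof.
move=> iF f v; apply: eq_bigr => v' _; congr (_ * _).
have [->|ik] := eqVneq i k; first by rewrite update_same.
by rewrite -update_comm// iF.
Qed.

Let indep_averages l F i : i \in l \/ indep i F -> indep i (averages l F).
Proof.
elim: l F i => [|k l IH] F i /=; first by case.
case=> [|iF]; last by apply: IH; right; exact: indep_average.
rewrite inE => /orP[/eqP ->|il]; apply: IH; last by left.
by right=> f v; apply: eq_bigr => v' _; rewrite update_same.
Qed.

Let indep_cst F f g : (forall i, indep i F) -> F f = F g.
Proof.
(* [h l] is [f] with the coordinates in [l] replaced by those of [g]. *)
move=> iF; pose h (l : seq I) := foldr (fun i h => update i (g i) h) f l.
have Fh l : F (h l) = F f by elim: l => //= i l IH; rewrite iF.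
have hE l i : i \in l -> h l i = g i.
  elim: l => //= k l IH; rewrite inE ffunE; case: eqP => [-> //|_ /=]; exact: IH.
rewrite -(Fh (enum I)); congr (F _); apply/ffunP => i; apply: hE.
by rewrite mem_enum.
Qed.

(** Once every coordinate is integrated out the function is constant, and each average preserves the
    expectation. *)
Let averages_enum F f : averages (enum I) F f = expect F.
Proof.
have iA i : indep i (averages (enum I) F).
  by apply: indep_averages; left; rewrite mem_enum.
have -> : expect F = expect (averages (enum I) F).
  by elim: (enum I) F {iA} => //= i l IH F; rewrite -IH expect_average.
rewrite -[LHS]expect_cst; apply: eq_bigr => g _; congr (_ * _).
exact: indep_cst.
Qed.

Variables (u : I -> V -> R) (d theta : R).
Hypothesis u_ge0 : forall i v, 0 <= u i v.
Hypothesis u_le : forall i v, q i v != 0 -> u i v <= d.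
Hypothesis theta_ge0 : 0 <= theta.
Hypothesis theta_d : 4 * theta * d <= 1.

Let lip (F : {ffun I -> V} -> R) := forall i v v' f,
  `|F (update i v f) - F (update i v' f)| <= u i v + u i v'.

Let lip_average k F : lip F -> lip (average k F).
Proof.
move=> lF i v v' f; rewrite /average -sumrB.
apply: le_trans (ler_norm_sum _ _ _) _.
rewrite -[leRHS]mul1r -(q_sum1 k) mulr_suml; apply: ler_sum => z _.
rewrite -mulrBr normrM ger0_norm// ler_wpM2l//.
have [<-|ik] := eqVneq i k; first by rewrite !update_same subrr normr0 addr_ge0.
by rewrite -!(update_comm _ _ _ ik) lF.
Qed.

(* Integrating out one variable at a time multiplies the exponential moment by
   the error factor of the one-variable bound. *)
Theorem bernstein (F : {ffun I -> V} -> R) :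
  (forall i v v' f, `|F (update i v f) - F (update i v' f)| <= u i v + u i v') ->
  expect (fun f => expR (theta * F f)) <=
  expR (theta * expect F + 8 * theta ^+ 2 * d * \sum_i \sum_v q i v * u i v).
Proof.
move=> lF.
have step l G : lip G -> expect (fun f => expR (theta * G f)) <=
    expR (8 * theta ^+ 2 * d * \sum_(i <- l) \sum_v q i v * u i v) *
    expect (fun f => expR (theta * averages l G f)).
  elim: l G => [|i l IH] G lG /=; first by rewrite big_nil mulr0 expR0 mul1r.
  rewrite big_cons mulrDr expRD -mulrA.
  apply: le_trans (ler_wpM2l (expR_ge0 _) (IH _ (lip_average i lG))).
  rewrite -expectZ -(expect_average i); apply: expect_le => f.
  rewrite -expRD addrC.
  by apply: mgf_one_variable => // v; exact: u_le.
apply: le_trans (step (enum I) F lF) _.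
rewrite expRD mulrC ler_pM ?expR_ge0//.
- by rewrite sumr_ge0// => f _; rewrite mulr_ge0 ?expR_ge0 ?weight_ge0.
- rewrite -[leRHS]expect_cst; apply: expect_le => f.
  by rewrite averages_enum.
- by rewrite big_enum.
Qed.

End Expectation.

(** * The probability of a long overload *)

Section Overload.
Variables (R : realType) (I : finType) (N p D : nat) (eps : R).
Local Notation V := {ffun 'I_N -> bool}.
Variable q : I -> V -> R.
Hypothesis q_ge0 : forall i v, 0 <= q i v.
Hypothesis q_sum1 : forall i, \sum_v q i v = 1.
Variable P : pred 'I_N.
Hypothesis D_gt0 : (0 < D)%N.
Hypothesis eps_gt0 : 0 < eps.
Hypothesis eps_le : eps <= 1 / 2.
Hypothesis eps2p : 1 <= eps ^+ 2 * p%:R.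
Hypothesis tail_le : 64 * expR (- (1 / 32 * eps ^+ 2 * p%:R)) <= D%:R^-1.
Hypothesis mean_le : forall t, P t ->
  \sum_i \sum_v q i v * (v t)%:R <= (1 - eps) * p%:R.
Hypothesis crossings_le : forall i v, q i v != 0 ->
  \sum_(t | P t) (v t)%:R <= D%:R :> R.

Definition crossing_count (t : 'I_N) (f : {ffun I -> V}) : R :=
  \sum_i (f i t)%:R.

(** The cut-off is halfway between the mean bound [(1 - eps) * p] and [p], so full steps exceed it
    by at least [eps * p / 2] on average while its expected excess is tiny. *)
Definition excess (t : 'I_N) (f : {ffun I -> V}) : R :=
  Num.max 0 (crossing_count t f - (1 - eps / 2) * p%:R).

Definition total_excess (f : {ffun I -> V}) : R := \sum_(t | P t) excess t f.

(** Independence factors the moment, and [1 + x <= expR x] bounds each factor, as in Chernoff's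
    bound. *)
Lemma crossing_count_mgf t (theta : R) : 0 <= theta -> P t ->
  expect q (fun f => expR (theta * crossing_count t f)) <=
  expR ((expR theta - 1) * ((1 - eps) * p%:R)).
Proof.
move=> t0 Pt; have -> : expect q (fun f => expR (theta * crossing_count t f)) =
    expect q (fun f => \prod_i expR (theta * (f i t)%:R)).
  apply: eq_bigr => f _; congr (_ * _); rewrite -expR_sum; congr expR.
  by rewrite mulr_sumr.
rewrite (expect_prod q (fun i v => expR (theta * (v t)%:R))).
have e0 : 0 <= expR theta - 1 by rewrite subr_ge0 -expR0 ler_expR.
apply: (@le_trans _ _ (\prod_i expR ((expR theta - 1) * \sum_v q i v * (v t)%:R))).
  apply: ler_prod => i _; rewrite sumr_ge0/=; last first.
    by move=> v _; rewrite mulr_ge0 ?expR_ge0.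
  have -> : \sum_v q i v * expR (theta * (v t)%:R) =
      1 + (expR theta - 1) * \sum_v q i v * (v t)%:R.
    rewrite [RHS](_ : _ = \sum_v (q i v + (expR theta - 1) * (q i v * (v t)%:R))).
      2: by rewrite big_split/= q_sum1 mulr_sumr.
    apply: eq_bigr => v _.
    by case: (v t); rewrite ?mulr1 ?mulr0 ?expR0; ring.
  exact: expR_ge1Dx.
by rewrite -expR_sum ler_expR -mulr_sumr ler_wpM2l// mean_le.
Qed.

(** Uses [max 0 y <= expR (theta * y) / theta] and the exponential moment of the count. *)
Lemma excess_mean t : P t ->
  expect q (excess t) <= eps * p%:R * D%:R^-1 / 8.
Proof.
(* This [theta] makes the exponent at most [- eps ^+ 2 * p / 32], the rate in [tail_le]; the factor
   64 there and [eps2p] absorb the factor [1 / theta]. *)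
move=> Pt; set theta := eps / 8.
have th0 : 0 < theta by rewrite divr_gt0.
have p0 : (0 : R) <= p%:R by [].
apply: (@le_trans _ _ (expect q (fun f => theta^-1 *
    (expR (- (theta * ((1 - eps / 2) * p%:R))) *
     expR (theta * crossing_count t f))))).
  apply: expect_le => // f; rewrite -expRD ler_pdivlMl//.
  rewrite -mulNr (_ : _ + _ = theta * (crossing_count t f - (1 - eps / 2) * p%:R)); last by ring.
  rewrite /excess; set y := _ - _.
  apply: (@le_trans _ _ (Num.max 0 (theta * y))).
    by rewrite maxr_pMr ?(ltW th0)// mulr0.
  rewrite ge_max expR_ge0 /=; apply: le_trans (expR_ge1Dx _).
  by rewrite lerDr.
rewrite !expectZ ler_pdivrMl//.
apply: le_trans (ler_wpM2l (expR_ge0 _) (crossing_count_mgf (ltW th0) Pt)) _.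
rewrite -expRD; apply: (@le_trans _ _ (D%:R^-1 / 64)).
  rewrite ler_pdivlMr// mulrC; apply: le_trans tail_le.
  rewrite ler_pM2l// ler_expR.
  have h : expR theta <= 1 + theta + 2 * theta ^+ 2.
    by apply: expR_le_quadratic; rewrite /theta; have := eps_le; have := eps_gt0; lra.
  have : (expR theta - 1) * ((1 - eps) * p%:R) <=
      (theta + 2 * theta ^+ 2) * ((1 - eps) * p%:R).
    by rewrite ler_wpM2r ?mulr_ge0//; have := eps_le; lra.
  have : 0 <= 2 * theta ^+ 2 * (eps * p%:R) by rewrite !mulr_ge0 ?sqr_ge0// ltW.
  by rewrite /theta; lra.
have : 0 <= (eps ^+ 2 * p%:R - 1) * D%:R^-1 by rewrite mulr_ge0 ?invr_ge0 ?subr_ge0.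
by rewrite /theta; lra.
Qed.

Lemma total_excess_lip i v v' f :
  `|total_excess (update i v f) - total_excess (update i v' f)| <=
  \sum_(t | P t) (v t)%:R + \sum_(t | P t) (v' t)%:R.
Proof.
rewrite -sumrB -big_split /=; apply: le_trans (ler_norm_sum _ _ _) _.
apply: ler_sum => t _.
have count v0 : crossing_count t (update i v0 f) =
    (v0 t)%:R + \sum_(k | k != i) (f k t)%:R.
  rewrite /crossing_count (bigD1 i)//= ffunE eqxx; congr (_ + _).
  by apply: eq_bigr => k ki; rewrite ffunE (negbTE ki).
rewrite /excess !count; move: (\sum_(k | _) _) => S.
have lip (a b : R) : `|Num.max 0 a - Num.max 0 b| <= `|a - b|.
  have := ler_norm (a - b); have := ler_norm (b - a); rewrite distrC ler_norml.
  by case: (leP 0 a) => ?; case: (leP 0 b) => ?; lra.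
apply: le_trans (lip _ _) _; rewrite ler_norml.
by case: (v t); case: (v' t) => /=; lra.
Qed.

Theorem overload_prob :
  expect q (fun f => (eps * p%:R * D%:R^-1 * #|P|%:R / 4 <= total_excess f)%R%:R) <=
  expR (- (D%:R^-1 ^+ 3 / 2048 * #|P|%:R)).
Proof.
have p0 : (0 : R) <= p%:R by [].
have D0 : (0 : R) < D%:R by rewrite ltr0n.
set delta : R := D%:R^-1; have d0 : 0 < delta by rewrite invr_gt0.
have d1 : delta <= 1 by rewrite invf_le1// ler1n.
have dD : delta * D%:R = 1 by rewrite mulVf// gt_eqF.
set T : R := #|P|%:R; have T0 : 0 <= T by [].
(* With this choice the mean takes half of the [1 / 4] and the variance term a quarter, leaving
   [theta * eps * p * delta * T / 16]. *)
set theta := eps * delta ^+ 2 / 128.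
have th0 : 0 <= theta by rewrite divr_ge0// mulr_ge0 ?sqr_ge0 ?(ltW eps_gt0).
have thD : theta * D%:R = eps * delta / 128.
  have -> : theta * D%:R = eps * delta * (delta * D%:R) / 128 by rewrite /theta; ring.
  by rewrite dD mulr1.
apply: le_trans (markov_exp q_ge0 _ _ th0) _.
have th4 : 4 * theta * D%:R <= 1.
  rewrite -mulrA thD; have : eps * delta <= 1 * 1.
    by apply: ler_pM; rewrite ?(ltW eps_gt0) ?(ltW d0)//; move: eps_le; lra.
  by lra.
have := @bernstein R I V q q_ge0 q_sum1 (fun _ v => \sum_(t | P t) (v t)%:R)
  D%:R theta (fun _ v => sumr_ge0 _ (fun t _ => ler0n R _)) crossings_le th0 th4
  _ total_excess_lip.
move=> /(ler_wpM2l (expR_ge0 (- (theta * (eps * p%:R * delta * T / 4))))).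
move/le_trans; apply; rewrite -expRD ler_expR.
have mean : expect q total_excess <= eps * p%:R * delta / 8 * T.
  rewrite expect_sum /T mulr_natr -sumr_const; apply: ler_sum => t Pt; exact: excess_mean.
(* The variance proxy is the expected total number of crossings, at most [p] per step. *)
have var : \sum_i \sum_v q i v * (\sum_(t | P t) (v t)%:R) <= p%:R * T.
  have -> : \sum_i \sum_v q i v * (\sum_(t | P t) (v t)%:R) =
      \sum_(t | P t) \sum_i \sum_v q i v * (v t)%:R.
    rewrite [RHS]exchange_big; apply: eq_bigr => i _; rewrite [RHS]exchange_big.
    by apply: eq_bigr => v _; rewrite mulr_sumr.
  rewrite /T mulr_natr -sumr_const; apply: ler_sum => t Pt; apply: le_trans (mean_le Pt) _.
  by rewrite ler_piMl// lerBlDr lerDl ltW.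
have m1 : theta * expect q total_excess <= theta * (eps * p%:R * delta / 8 * T).
  exact: ler_wpM2l.
have m2 : 8 * theta ^+ 2 * D%:R * (\sum_i \sum_v q i v * (\sum_(t | P t) (v t)%:R))
    <= 8 * theta * (theta * D%:R) * (p%:R * T).
  rewrite (_ : 8 * theta * (theta * D%:R) = 8 * theta ^+ 2 * D%:R); last by ring.
  by rewrite ler_wpM2l// mulr_ge0// mulr_ge0// sqr_ge0.
have m3 : delta ^+ 3 * T <= eps ^+ 2 * p%:R * (delta ^+ 3 * T).
  by rewrite ler_peMl// mulr_ge0 ?exprn_ge0 ?(ltW d0).
move: m1 m2 m3; rewrite thD /theta; lra.
Qed.

End Overload.

(** * From the offsets to finitely many crossing patterns *)

Section FiniteValued.
Variables (R : realType) (d : measure_display) (T : measurableType d).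
Variables (P : probability T R) (V : finType) (X : T -> V).
Hypothesis mX : forall v, measurable [set w | X w = v].

Lemma measurable_finite_valued (A : pred V) : measurable [set w | A (X w)].
Proof.
have -> : [set w | A (X w)] = \bigcup_(v in [set v | A v]) [set w | X w = v].
  by apply/seteqP; split=> [w /= Aw|w [v /= Av ->]] //; exists (X w).
by apply: fin_bigcup_measurable => //; exact: finite_finset.
Qed.

Lemma prob_finite_valued (A : pred V) :
  P [set w | A (X w)] = (\sum_(v | A v) fine (P [set w | X w = v]))%:E.
Proof.
rewrite -big_filter; set l := [seq v <- _ | _].
have ul : uniq l by rewrite filter_uniq// index_enum_uniq.
have -> : [set w | A (X w)] = [set w | X w \in l].
  by apply/seteqP; split=> w /=; rewrite mem_filter mem_index_enum andbT.
elim: l ul => [|v l IH] /= => [_|/andP[vl ul]].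
  by rewrite big_nil (_ : [set _ | _] = set0) ?measure0//; apply/seteqP; split.
rewrite big_cons EFinD fineK ?fin_num_measure// -IH// -measureU//.
- congr (P _); apply/seteqP; split=> w /=; rewrite inE.
    by case/orP => [/eqP|]; [left|right].
  by case=> [->|->]; rewrite ?eqxx ?orbT.
- exact: (measurable_finite_valued [pred v | v \in l]).
- by apply/seteqP; split=> // w /= [Xv Xl]; move: vl; rewrite -Xv Xl.
Qed.

End FiniteValued.

(** The density vanishes outside [[0, 1]], so both endpoints can be clamped to it. *)
Lemma uniform01_itv_le (R : realType) (a b : R) : a <= b ->
  (uniform_prob (@ltr01 R) `]a, b] <=
   (Num.min (Num.max b 0) 1 - Num.min (Num.max a 0) 1)%:E)%E.
Proof.
move=> ab; set a' := Num.min (Num.max a 0) 1; set b' := Num.min (Num.max b 0) 1.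
have ab' : a' <= b'.
  by rewrite le_min !ge_min lexx orbT andbT ge_max !le_max ab lexx !orbT.
have a'0 : 0 <= a' by rewrite le_min ler01 le_max lexx orbT.
have b'1 : b' <= 1 by rewrite ge_min lexx orbT.
rewrite /uniform_prob integral_uniform_pdf.
apply: (@le_trans _ _ (\int[lebesgue_measure]_(x in `[a', b']) (uniform_pdf 0 1 x)%:E)%E).
  apply: ge0_subset_integral => //.
  - by apply: measurableI => //; exact: measurable_itv.
  - apply: (@measurable_funS _ _ _ _ setT) => //; apply: measurableT_comp => //.
    exact: measurable_uniform_pdf.
  - by move=> x _; rewrite lee_fin uniform_pdf_ge0.
  - move=> x /= []; rewrite !in_itv/= => /andP[ax xb] /andP[x0 x1].
    rewrite /a' /b' ge_min ge_max le_min le_max (ltW ax) xb x0 x1 /=.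
    by [].
rewrite (_ : (\int[lebesgue_measure]_(x in `[a', b']) (uniform_pdf 0 1 x)%:E)%E =
   (\int[lebesgue_measure]_(x in `[a', b']) (cst 1%:E x))%E); last first.
  apply: eq_integral => x; rewrite inE/= in_itv/= => /andP[ax xb].
  rewrite /uniform_pdf ifT ?subr0 ?invr1//; apply/andP; split; lra.
rewrite integral_cst//= mul1e lebesgue_measure_itv /= lte_fin.
by case: ifP => // _; rewrite lee_fin subr_ge0.
Qed.

(** Each summand is the length of the part of [[0, x]] in the cell [[z, z + 1]]; the cells tile
    [[0, K]]. *)
Lemma sum_unit_cells (R : realType) (x : R) (K : nat) :
  \sum_(z < K) Num.min (Num.max (x - z%:R) 0) 1 = Num.min (Num.max x 0) K%:R.
Proof.
elim: K => [|K IH]; first by rewrite big_ord0 min_r// le_max lexx orbT.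
rewrite big_ord_recr/= IH -[K.+1%:R]natr1.
have : (0 : R) <= K%:R by [].
move: (K%:R : R) => k k0; have [xk|kx] := leP x k.
  have xk' : Num.max x 0 <= k by rewrite ge_max xk.
  rewrite [Num.max (x - k) 0]max_r ?subr_le0// [Num.min 0 1]min_l// addr0.
  by rewrite !min_l// ler_wpDr.
have x0 : 0 < x := le_lt_trans k0 kx.
rewrite !max_l ?subr_ge0 ?(ltW kx) ?(ltW x0)// [Num.min x k]min_r ?(ltW kx)//.
by rewrite addr_minr addrC subrK.
Qed.

Lemma sum_unit_cells_diff_le (R : realType) (x y : R) (K : nat) : x <= y ->
  \sum_(z < K) (Num.min (Num.max (y - z%:R) 0) 1 - Num.min (Num.max (x - z%:R) 0) 1)
  <= y - x.
Proof.
move=> xy; rewrite sumrB !sum_unit_cells.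
have xm : x <= Num.max x 0 by rewrite le_max lexx.
have m0 : 0 <= Num.max x 0 by rewrite le_max lexx orbT.
rewrite lerBlDl addr_minl le_min !ge_min ge_max.
by apply/andP; split; apply/orP; [left; apply/andP; split|right]; lra.
Qed.

(** The half-open intervals are disjoint, and the one for [t = 0] is empty since [0.-1 = 0]. The
    bound [y <= a N] carries the induction. *)
Lemma sum_interval_hits (R : realType) (a : nat -> R) (y : R) (N : nat) :
  {homo a : i k / (i <= k)%N >-> i <= k} ->
  (\sum_(t < N.+1) ((a t.-1 < y) && (y <= a t))%R <= (y <= a N)%R)%N.
Proof.
move=> mono; elim: N => [|N IH].
  by rewrite big_ord1 /=; case: ltP => // /ltW.
rewrite big_ord_recr /=; apply: leq_trans (leq_add IH (leqnn _)) _.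
have := mono _ _ (leqnSn N).
by case: (leP y (a N)) => [yN aN|yN _]; rewrite ?(le_trans yN aN).
Qed.

(** * Laws of the crossing patterns *)

Section Patterns.
Variables (R : realType) (n D : nat) (c : nat -> 'I_n -> R).
Hypothesis D_gt0 : (0 < D)%N.
Hypothesis pour01 : forall i j, (0 < i)%N -> 0 <= c i j <= 1.

Lemma poured_total_homo j :
  {homo poured_total c j : i k / (i <= k)%N >-> i <= k}.
Proof.
move=> i k /subnKC <-; elim: (k - i)%N => [|l IH]; first by rewrite addn0.
rewrite addnS; apply: le_trans IH _; rewrite poured_totalS lerDl.
by case/andP: (pour01 j (ltn0Sn (i + l))).
Qed.

Lemma poured_total_le_steps j i : poured_total c j i <= i%:R.
Proof.
elim: i => [|i IH]; first by rewrite /poured_total big_geq.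
rewrite poured_totalS -[i.+1%:R]natr1 lerD//.
by case/andP: (pour01 j (ltn0Sn i)).
Qed.

(* Some threshold of the [m]-th block is crossed if its offset is [x]. *)
Definition hit (j : 'I_n) (m t : nat) (x : R) : bool :=
  [exists tau : 'I_D, (poured_total c j t.-1 <
     ((m * D.+1).+1 + tau.+1)%:R + x <= poured_total c j t)%R].

Let hit_itv (j : 'I_n) (m t tau : nat) : set R :=
  `]poured_total c j t.-1 - ((m * D.+1).+1 + tau.+1)%:R,
    poured_total c j t - ((m * D.+1).+1 + tau.+1)%:R]%classic.

Let hit_setE j m t :
  [set x | hit j m t x] = \big[setU/set0]_(tau < D) hit_itv j m t tau.
Proof.
rewrite -bigcup_mkord; apply/seteqP; split=> [x /existsP[tau h]|x [tau tauD h]].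
  by exists tau => //=; rewrite /hit_itv /= in_itv/= ltrBlDl lerBrDl.
apply/existsP; exists (Ordinal tauD).
by move: h; rewrite /hit_itv /= in_itv/= ltrBlDl lerBrDl.
Qed.

Lemma measurable_hit j m t : measurable [set x | hit j m t x].
Proof. by rewrite hit_setE; apply: bigsetU_measurable => k _; exact: measurable_itv. Qed.

Lemma hits_le j m N x : (\sum_(t < N.+1) hit j m t x <= D)%N.
Proof.
apply: (@leq_trans (\sum_(t < N.+1) \sum_(tau < D) (poured_total c j t.-1 <
     ((m * D.+1).+1 + tau.+1)%:R + x <= poured_total c j t)%R)).
  apply: leq_sum => t _; rewrite /hit; case: existsP => // -[tau h].
  by rewrite (bigD1 tau)//= h.
rewrite exchange_big -[X in (_ <= X)%N]card_ord -sum1_card.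
apply: leq_sum => tau _.
by apply: leq_trans (sum_interval_hits _ _ (poured_total_homo j)) (leq_b1 _).
Qed.

Lemma uniform_hit_le j m t : (uniform_prob (@ltr01 R) [set x | hit j m t x] <=
  (\sum_(tau < D)
     (Num.min (Num.max (poured_total c j t - ((m * D.+1).+1 + tau.+1)%:R) 0) 1 -
      Num.min (Num.max (poured_total c j t.-1 - ((m * D.+1).+1 + tau.+1)%:R) 0) 1))%:E)%E.
Proof.
rewrite hit_setE; apply: le_trans (Boole_inequality _ _) _.
  by move=> k _; exact: measurable_itv.
rewrite -sumEFin; apply: lee_sum => tau _; rewrite /hit_itv; apply: uniform01_itv_le.
by rewrite lerD2r poured_total_homo// leq_pred.
Qed.

(** The cells of all thresholds are disjoint unit intervals, so together they meet the interval
    poured in step [t] in length at most [c t j]. The first cell starts at 2. *)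
Lemma sum_uniform_hits_le j t M : (0 < t)%N ->
  \sum_(m < M) \sum_(tau < D)
     (Num.min (Num.max (poured_total c j t - ((m * D.+1).+1 + tau.+1)%:R) 0) 1 -
      Num.min (Num.max (poured_total c j t.-1 - ((m * D.+1).+1 + tau.+1)%:R) 0) 1)
  <= c t j.
Proof.
case: t => // t _ /=.
set a := poured_total c j t; set b := poured_total c j t.+1.
have ab : a <= b by exact: poured_total_homo.
pose G (z : nat) : R := Num.min (Num.max (b - 2 - z%:R) 0) 1 -
  Num.min (Num.max (a - 2 - z%:R) 0) 1.
have G0 z : 0 <= G z.
  rewrite subr_ge0 le_min !ge_min lexx orbT andbT ge_max !le_max lexx orbT andbT.
  by rewrite !lerD2r ab.
apply: (@le_trans _ _ (\sum_(z < M * D.+1) G z)); last first.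
  apply: le_trans (sum_unit_cells_diff_le _ _) _; first by rewrite lerD2r.
  by rewrite /b poured_totalS -/a; lra.
rewrite -(big_mkord xpredT G) big_nat_mul big_mkord; apply: ler_sum => m _.
have -> : \sum_(m * D.+1 <= z < m.+1 * D.+1) G z =
    \sum_(tau < D.+1) G (tau + m * D.+1)%N.
  by rewrite -{1}[(m * D.+1)%N]add0n big_addn mulSn addnK big_mkord.
(* The last of each [D + 1] consecutive cells holds no threshold and is dropped, as [G] is
   nonnegative. *)
rewrite big_ord_recr /=.
rewrite ler_wpDr//; apply: ler_sum => tau _.
have h x : x - ((m * D.+1).+1 + tau.+1)%:R = x - 2 - (tau + m * D.+1)%:R :> R.
  by rewrite addnS addSn -addn2 natrD addnC; ring.
by rewrite !h.
Qed.

(** At most [i] units are poured by step [i], so only blocks [m <= i] matter and finitely many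
    offsets decide. *)
Lemma crosses_hit (s : 'I_n -> nat -> R) j i t :
  (forall j i, block_start D i -> 0 < s j i <= 1) -> (t <= i)%N ->
  crosses D c s j t = [exists m : 'I_i.+1, hit j m t (s j (m * D.+1).+1)].
Proof.
move=> offset ti; apply/asboolP/existsP => [[y [[b [tau]]]]|[m /existsP[tau h]]].
  case=> bb /andP[tau1 tauD] -> /= h.
  have [m bE] := block_startP b D_gt0 bb.
  have mi : (m < i.+1)%N.
    have : (b + tau)%:R <= (i%:R : R).
      case/andP: h => _ h; apply: le_trans (poured_total_le_steps j i).
      apply: le_trans (poured_total_homo j ti); apply: le_trans h.
      by rewrite lerDl; case/andP: (offset j _ bb) => /ltW.
    by rewrite ler_nat bE; nia.
  exists (Ordinal mi); apply/existsP.
  have tauD' : (tau.-1 < D)%N by rewrite prednK.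
  by exists (Ordinal tauD') => /=; rewrite prednK// -bE.
exists (((m * D.+1).+1 + tau.+1)%:R + s j (m * D.+1).+1); split => //.
exists (m * D.+1).+1, tau.+1; split => //; first by apply/(block_startP _ D_gt0); exists m.
exact: ltn_ord.
Qed.

Variable i : nat.
Local Notation J := ('I_n * 'I_i.+1)%type.
Local Notation V := {ffun 'I_i.+1 -> bool}.

(** All that steps up to [i] reveal about the offset [x] of block [k.2] of cup [k.1]. *)
Definition pattern (k : J) (x : R) : V := [ffun t : 'I_i.+1 => hit k.1 k.2 t x].

Lemma measurable_pattern k v : measurable [set x | pattern k x = v].
Proof.
have -> : [set x | pattern k x = v] =
    \bigcap_(t in [set: 'I_i.+1]) [set x | hit k.1 k.2 t x = v t].
  apply/seteqP; split=> [x <- t _|x h] /=; first by rewrite ffunE.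
  by apply/ffunP => t; rewrite ffunE; exact: h.
apply: fin_bigcap_measurable; first exact: finite_finset.
move=> t _; case: (v t); first exact: measurable_hit.
rewrite (_ : [set _ | _] = ~` [set x | hit k.1 k.2 t x]).
  by apply: measurableC; exact: measurable_hit.
by apply/seteqP; split=> x /=; [move=> ->|move/negP/negbTE].
Qed.

Variables (d : measure_display) (T : measurableType d) (P : probability T R).
Variable s : 'I_n -> nat -> {RV P >-> R}.
Hypothesis offsets : random_offsets D s.

Definition offset_of (k : J) : {RV P >-> R} := s k.1 (k.2 * D.+1).+1.

Definition pattern_prob (k : J) (v : V) : R :=
  fine (P [set w | pattern k (offset_of k w) = v]).

Lemma block_start_offset (k : J) : block_start D (k.2 * D.+1).+1.
Proof. by apply/(block_startP _ D_gt0); exists k.2. Qed.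

Lemma measurable_offset_pattern k v :
  measurable [set w | pattern k (offset_of k w) = v].
Proof. exact: (measurable_funPTI (offset_of k) (measurable_pattern k v)). Qed.

Lemma pattern_prob_ge0 k v : 0 <= pattern_prob k v.
Proof. by rewrite fine_ge0. Qed.

Lemma pattern_prob_sum1 k : \sum_v pattern_prob k v = 1.
Proof.
have := prob_finite_valued P (measurable_offset_pattern k) predT.
rewrite (_ : [set _ | _] = setT) ?probability_setT => [[->]//|].
by apply/seteqP; split.
Qed.

(** A pattern of nonzero probability is realised by some offset, and each of the [D] thresholds of a
    block is crossed at most once. *)
Lemma pattern_prob_crossings k v (A : pred 'I_i.+1) : pattern_prob k v != 0 ->
  \sum_(t | A t) (v t)%:R <= D%:R :> R.
Proof.
rewrite /pattern_prob; have [->|/set0P[w /= <-] _] :=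
  eqVneq [set w | pattern k (offset_of k w) = v] set0.
  by rewrite measure0 eqxx.
rewrite -natr_sum ler_nat; apply: leq_trans (hits_le k.1 k.2 i (offset_of k w)).
rewrite big_mkcond; apply: leq_sum => t _; rewrite ffunE.
by case: ifP.
Qed.

Lemma pattern_prob_mean (eps : R) (p : nat) (t : 'I_i.+1) : (0 < t)%N ->
  \sum_j c t j <= (1 - eps) * p%:R ->
  \sum_k \sum_v pattern_prob k v * (v t)%:R <= (1 - eps) * p%:R.
Proof.
move=> t0; apply: le_trans.
rewrite -(pair_big xpredT xpredT (fun j m => \sum_v pattern_prob (j, m) v * (v t)%:R)) /=.
apply: ler_sum => j _; apply: le_trans (sum_uniform_hits_le j i.+1 t0).
apply: ler_sum => m _.
have -> : \sum_v pattern_prob (j, m) v * (v t)%:R = \sum_(v : V | v t) pattern_prob (j, m) v.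
  rewrite [RHS]big_mkcond; apply: eq_bigr => v _.
  by case: (v t); rewrite ?mulr1 ?mulr0.
rewrite -lee_fin.
rewrite -(prob_finite_valued P (measurable_offset_pattern (j, m)) (fun v : V => v t)).
apply: le_trans (uniform_hit_le j m t).
have [U _] := offsets.
have [_ <-] := U j _ (block_start_offset (j, m)); last exact: measurable_hit.
rewrite /distribution /pushforward.
rewrite (_ : [set w | _] = offset_of (j, m) @^-1` [set x | hit j m t x]) //.
by apply/seteqP; split=> w /=; rewrite ffunE.
Qed.

Definition all_patterns (w : T) : {ffun J -> V} :=
  [ffun k => pattern k (offset_of k w)].

Lemma all_patterns_setE f : [set w | all_patterns w = f] =
  \bigcap_(k in [set: J]) [set w | pattern k (offset_of k w) = f k].
Proof.
apply/seteqP; split=> [w <- k _ /=|w h] /=; first by rewrite ffunE.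
by apply/ffunP => k; rewrite ffunE; exact: h.
Qed.

Lemma measurable_all_patterns f : measurable [set w | all_patterns w = f].
Proof.
rewrite all_patterns_setE; apply: fin_bigcap_measurable; first exact: finite_finset.
by move=> k _; exact: measurable_offset_pattern.
Qed.

(** Independence of the offsets makes the joint law a product; [key] translates pairs of cup and
    block number into indices of offsets. *)
Lemma prob_all_patterns f :
  fine (P [set w | all_patterns w = f]) = weight pattern_prob f.
Proof.
pose key (k : J) : 'I_n * nat := (k.1, (k.2 * D.+1).+1).
pose unkey (b : 'I_n * nat) : J := (b.1, inord (b.2 %/ D.+1)).
have keyK : cancel key unkey.
  case=> j m; rewrite /unkey /key /=; congr (_, _).
  by rewrite -[(m * D.+1).+1]addn1 divnMDl// divn_small// addn0 inord_val.
have [_ indep] := offsets.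
have sub : [set` [fset key k | k : J]%fset] `<=` [set ji | block_start D ji.2].
  by move=> _ /= /imfsetP[k _ ->]; exact: block_start_offset.
have := indep [fset key k | k : J]%fset
  (fun b => [set x | pattern (unkey b) x = f (unkey b)]) sub
  (fun b _ => measurable_pattern (unkey b) (f (unkey b))).
rewrite big_imfset/=; last by move=> ? ? _ _; exact: (can_inj keyK).
rewrite (_ : \bigcap_(b in _) _ = [set w | all_patterns w = f]); last first.
  rewrite all_patterns_setE; apply/seteqP; split=> w h.
    move=> k _; have := h (key k); rewrite keyK; apply => /=.
    by apply/imfsetP; exists k.
  by move=> _ /= /imfsetP[k _ ->]; rewrite keyK; exact: (h k I).
move=> ->; rewrite /weight.
rewrite (eq_bigr (fun k => (pattern_prob k (f k))%:E)); last first.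
  move=> k _; rewrite fineK ?fin_num_measure//; last exact: measurable_offset_pattern.
  by rewrite keyK.
by rewrite prodEFin /= big_enum.
Qed.

Lemma prob_all_patterns_pred (A : pred {ffun J -> V}) :
  P [set w | A (all_patterns w)] = (expect pattern_prob (fun f => (A f)%:R))%:E.
Proof.
rewrite (prob_finite_valued P measurable_all_patterns) /expect big_mkcond.
congr EFin; apply: eq_bigr => f _; rewrite prob_all_patterns.
by case: (A f); rewrite ?mulr1 ?mulr0.
Qed.

End Patterns.

(** * Resets *)

(** The [F] full steps carry at least [(p + 1) * F] crossings, so their excess is at least
    [F * eps * p / 2], and [T <= (D + 2) * F <= 2 * D * F]. *)
Lemma no_reset_excess (R : realType) (n D p i t0 : nat) (eps : R) (I : finType)
    (cr : 'I_n -> nat -> bool) (sel : nat -> {set 'I_n})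
    (f : {ffun I -> {ffun 'I_i.+1 -> bool}}) :
  (1 < D)%N -> 0 <= eps -> (t0 <= i)%N -> work_conserving D p cr sel ->
  (forall j, load D cr sel t0 j = 0%N) ->
  (forall t, (t0 < t <= i)%N -> exists j, load D cr sel t j != 0%N) ->
  (forall t : 'I_i.+1, (0 < t)%N -> (\sum_j cr j t)%:R <= crossing_count R t f) ->
  eps * p%:R * D%:R^-1 * #|[pred t : 'I_i.+1 | (t0 < t)%N]|%:R / 4 <=
  total_excess p eps [pred t : 'I_i.+1 | (t0 < t)%N] f.
Proof.
move=> D1 eps0 t0i wc W0 noreset count.
have shift (A : nat -> R) : \sum_(t < i.+1 | (t0 < t)%N) A t =
    \sum_(t < i - t0) A (t0 + t).+1.
  rewrite -(big_geq_mkord t0.+1 i.+1 xpredT) -[t0.+1]add0n big_addn subSS big_mkord.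
  by apply: eq_bigr => t _; rewrite addnS addnC.
set T := (i - t0)%N.
have -> : #|[pred t : 'I_i.+1 | (t0 < t)%N]|%:R = T%:R :> R.
  rewrite -sum1_card natr_sum (shift (fun=> 1%:R)) sumr_const card_ord.
  by rewrite -mulr_natl mulr1.
set F := (\sum_(t < T) full_step D p cr sel (t0 + t))%N.
have TF : (T <= D.+2 * F)%N.
  apply: full_steps_count => // t tT; apply: noreset.
  by rewrite ltnS leq_addr /= -ltn_subRL.
have := full_steps_crossings wc T W0; rewrite -/F => FX.
pose a : R := (1 - eps / 2) * p%:R.
have tot : \sum_(t < T | full_step D p cr sel (t0 + t))
    ((\sum_j cr j (t0 + t).+1)%:R - a) <= total_excess p eps [pred t : 'I_i.+1 | (t0 < t)%N] f.
  pose A t : R := excess p eps (inord t) f.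
  rewrite /total_excess (eq_bigr (fun t : 'I_i.+1 => A t)); last first.
    by move=> t _; rewrite /A inord_val.
  rewrite (shift A) big_mkcond; apply: ler_sum => t _; rewrite /A /excess -/a.
  have ti : ((t0 + t).+1 < i.+1)%N by rewrite ltnS -ltn_subRL.
  case: ifP => _; last by rewrite le_max lexx.
  rewrite le_max lerD2r; apply/orP; right.
  have -> : inord (t0 + t).+1 = Ordinal ti by apply/val_inj; rewrite /= inordK.
  exact: (count (Ordinal ti)).
apply: le_trans tot; rewrite sumrB sumr_const -natr_sum.
have -> : #|[pred t : 'I_T | full_step D p cr sel (t0 + t)]| = F.
  by rewrite /F -sum1_card big_mkcond; apply: eq_bigr => t _; rewrite inE; case: full_step.
move: FX TF; rewrite -!(ler_nat R) !natrM => FX TF.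
have D2 : (2 : R) <= D%:R by rewrite ler_nat.
have D0 : (0 : R) < D%:R by lra.
have TF' : T%:R * D%:R^-1 <= 2 * F%:R :> R.
  rewrite ler_pdivrMr//; apply: le_trans TF _; rewrite -!natr1.
  have : (2 : R) * F%:R <= D%:R * F%:R by rewrite ler_wpM2r.
  by lra.
have : eps * p%:R * (T%:R * D%:R^-1) <= eps * p%:R * (2 * F%:R).
  by rewrite ler_wpM2l// mulr_ge0.
rewrite -[_ *+ F]mulr_natl; move: FX; rewrite -natr1 /a.
have : (0 : R) <= F%:R by [].
lra.
Qed.

Lemma load_ext (n D i : nat) (cr cr' : 'I_n -> nat -> bool)
    (sel sel' : nat -> {set 'I_n}) (t : nat) (j : 'I_n) :
  (forall j t, (0 < t <= i)%N -> cr j t = cr' j t) ->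
  (forall t, (0 < t <= i)%N -> sel t = sel' t) -> (t <= i)%N ->
  load D cr sel t j = load D cr' sel' t j.
Proof.
move=> ecr esel; elim: t => //= t IH ti.
by rewrite IH ?(ltnW ti)// ecr ?ti// esel ?ti.
Qed.

(** A geometric tail of ratio [r = expR (- g)], where [1 / (1 - r) <= 1 + 1 / g <= expR g^-1]. *)
Lemma sum_expR_tail_le (R : realType) (g : R) (M i : nat) : 0 < g ->
  \sum_(t < i.+1 | (M <= i - t)%N) expR (- (g * (i - t)%:R)) <=
  expR (- (g * M%:R)) * expR g^-1.
Proof.
move=> g0; set r := expR (- g).
have r0 : 0 < r by exact: expR_gt0.
have rX m : expR (- (g * m%:R)) = r ^+ m by rewrite -expRM_natr mulNr.
have r1 : (1 - r) * expR g^-1 >= 1.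
  have h1 : r * (1 + g) <= 1.
    rewrite -[leRHS]expR0 -(addNr g) expRD ler_wpM2l ?(ltW r0)//; exact: expR_ge1Dx.
  have h2 : g <= (1 - r) * (1 + g) by lra.
  have h3 : 1 + g^-1 <= expR g^-1 by exact: expR_ge1Dx.
  have r1 : 0 <= 1 - r by rewrite subr_ge0 -expR0 ler_expR oppr_le0 ltW.
  apply: le_trans (ler_wpM2l r1 h3).
  have -> : (1 - r) * (1 + g^-1) = (1 - r) * (1 + g) / g by field; rewrite gt_eqF.
  by rewrite ler_pdivlMr// mul1r.
rewrite (reindex_inj rev_ord_inj) /=.
rewrite (eq_bigl (fun t : 'I_i.+1 => (M <= t)%N)); last first.
  by move=> t; rewrite subSS subKn// -ltnS.
rewrite (eq_bigr (fun t : 'I_i.+1 => r ^+ t)); last first.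
  by move=> t _; rewrite rX subSS subKn// -ltnS.
rewrite rX -(big_geq_mkord M i.+1 xpredT) -[M in X in X <= _]add0n big_addn big_mkord.
under eq_bigr do rewrite exprD mulrC.
rewrite -mulr_sumr ler_wpM2l ?exprn_ge0 ?(ltW r0)//.
set S := \sum_(_ < _) _; have S0 : 0 <= S by apply: sumr_ge0 => t _; rewrite exprn_ge0 ?ltW.
have : (1 - r) * S <= 1.
  rewrite -opprB mulNr -subrX1 opprB lerBlDr lerDl exprn_ge0// ltW//.
move=> h; rewrite -[leLHS]mul1r.
apply: le_trans (ler_wpM2r S0 r1) _; rewrite mulrAC.
by rewrite ler_piMl// expR_ge0.
Qed.

(** * The last reset and the backlog after step [i] *)

Section Backlog.
Variables (R : realType) (n p D : nat) (eps : R).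
Hypothesis D_gt1 : (1 < D)%N.
Hypothesis eps_gt0 : 0 < eps.
Hypothesis eps_le : eps <= 1 / 2.
Hypothesis eps2p : 1 <= eps ^+ 2 * p%:R.
Hypothesis tail_le : 64 * expR (- (1 / 32 * eps ^+ 2 * p%:R)) <= D%:R^-1.
Variables (d : measure_display) (T : measurableType d) (P : probability T R).
Variable s : 'I_n -> nat -> {RV P >-> R}.
Hypothesis offsets : random_offsets D s.
Variable c : nat -> 'I_n -> R.
Hypothesis filler : oblivious_filler p eps c.
Variable sel : nat -> T -> {set 'I_n}.
Hypothesis measurable_sel :
  forall (i : nat) (A : {set 'I_n}), measurable [set w | sel i w = A].
Hypothesis greedy : forall w,
  smoothed_greedy p D D%:R^-1 c (fun j i => s j i w) (fun i => sel i w).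
Variable i : nat.

Local Notation J := ('I_n * 'I_i.+1)%type.
Local Notation V := {ffun 'I_i.+1 -> bool}.
Local Notation patterns := (all_patterns D c i s).
Local Notation state_of w :=
  (run D D%:R^-1 c (fun j i' => s j i' w) (fun i' => sel i' w) i).

Let D_gt0 : (0 < D)%N := ltnW D_gt1.

Let pour01 l j : (0 < l)%N -> 0 <= c l j <= 1.
Proof. by move=> /filler[]. Qed.

Let offset w j l : block_start D l -> 0 < s j l w <= 1.
Proof. by move=> bl; case: (offsets.1 j l bl). Qed.

Let crossed_of (f : {ffun J -> V}) (j : 'I_n) (t : nat) : bool :=
  [exists m : 'I_i.+1, f (j, m) (inord t)].

Let crosses_patterns w j t : (t <= i)%N ->
  crosses D c (fun j i' => s j i' w) j t = crossed_of (patterns w) j t.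
Proof.
move=> ti; rewrite (crosses_hit D_gt0 pour01 j (offset w) ti).
by apply: eq_existsb => m; rewrite !ffunE inordK.
Qed.

(** [t0] ranges over the possible last resets at least [M] steps back; each would force the stated
    excess. *)
Definition long_overload (M : nat) (f : {ffun J -> V}) : bool :=
  [exists t0 : 'I_i.+1, (M <= i - t0)%N &&
    (eps * p%:R * D%:R^-1 * #|[pred t : 'I_i.+1 | (t0 < t)%N]|%:R / 4 <=
     total_excess p eps [pred t : 'I_i.+1 | (t0 < t)%N] f)].

Lemma long_overload_prob M : (P [set w | long_overload M (patterns w)] <=
  (expR (- (D%:R^-1 ^+ 3 / 2048 * M%:R)) * expR (D%:R^-1 ^+ 3 / 2048)^-1)%:E)%E.
Proof.
rewrite (prob_all_patterns_pred c D_gt0 offsets (long_overload M)) lee_fin.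
have g0 : 0 < D%:R^-1 ^+ 3 / 2048 :> R.
  by rewrite divr_gt0 ?exprn_gt0 ?invr_gt0 ?ltr0n.
apply: le_trans (sum_expR_tail_le M i g0).
pose B (t0 : 'I_i.+1) (f : {ffun J -> V}) :=
  (eps * p%:R * D%:R^-1 * #|[pred t : 'I_i.+1 | (t0 < t)%N]|%:R / 4 <=
     total_excess p eps [pred t : 'I_i.+1 | (t0 < t)%N] f).
apply: (@le_trans _ _ (expect (pattern_prob D c s)
    (fun f => \sum_(t0 < i.+1 | (M <= i - t0)%N) (B t0 f)%:R))).
  apply: expect_le; first exact: pattern_prob_ge0.
  move=> f; rewrite /long_overload; case: existsP => [[t0 /andP[Mt0 Bt0]]|_].
    by rewrite (bigD1 t0)//= /B Bt0 lerDl sumr_ge0.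
  by rewrite sumr_ge0.
rewrite expect_sum; apply: ler_sum => t0 _.
have card_later : #|[pred t : 'I_i.+1 | (t0 < t)%N]| = (i - t0)%N.
  rewrite -sum1_card -(big_geq_mkord t0.+1 i.+1 xpredT (fun=> 1%N)).
  by rewrite sum_nat_const_nat muln1 subSS.
rewrite -card_later.
apply: overload_prob => //.
- exact: pattern_prob_ge0.
- exact: pattern_prob_sum1.
- move=> t /= t0t; apply: (pattern_prob_mean D_gt0 pour01 offsets).
    exact: leq_ltn_trans t0t.
  by case: (filler (leq_ltn_trans (leq0n _) t0t)).
- by move=> k v /=; apply: pattern_prob_crossings.
Qed.

(** Without long overload the last reset is fewer than [M] steps back, and the deterministic growth
    bound applies from there. *)
Lemma fill_not_overloaded M w j : ~~ long_overload M (patterns w) ->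
  expR (eps * fill (state_of w) j) <= expR (eps * 6) * (M%:R * p%:R + 1).
Proof.
move=> nbad; pose cr := crosses D c (fun j i' => s j i' w).
pose W := load D cr (fun i' => sel i' w).
have [t0 /forallP reset t0max] :
    {t0 : 'I_i.+1 | [forall l, W t0 l == 0%N] &
     forall t : 'I_i.+1, [forall l, W t l == 0%N] -> (t <= t0)%N}.
  (* Time 0 is a reset, so a last one exists. *)
  pose t0 := [arg max_(t > (ord0 : 'I_i.+1) | [forall l, W t l == 0%N]) (t : nat)].
  exists t0; rewrite /t0; case: arg_maxnP => //; try exact/forallP.
have W0 l : W t0 l = 0%N by apply/eqP.
have t0i : (t0 <= i)%N by rewrite -ltnS.
have lt : (i - t0 < M)%N.
  rewrite ltnNge; apply: contraNN nbad => Mt0; apply/existsP; exists t0.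
  rewrite Mt0 /=; apply: (no_reset_excess (cr := cr) (sel := fun i' => sel i' w)) => //.
  - exact: ltW.
  - exact: (greedy_work_conserving D_gt0 (offset w) pour01 (greedy w)).
  - move=> t /andP[t0t ti]; apply/existsP; rewrite -negb_forall.
    by apply: contraL t0t => /(t0max (Ordinal (ti : (t < i.+1)%N))); rewrite -leqNgt.
  - move=> t t_gt0; rewrite /crossing_count natr_sum.
    have -> : \sum_k (patterns w k t)%:R =
        \sum_l \sum_m (patterns w (l, m) t)%:R :> R.
      by rewrite pair_big; apply: eq_bigr => -[].
    apply: ler_sum => l _; rewrite /cr crosses_patterns -1?ltnS//.
    rewrite -natr_sum ler_nat /crossed_of; case: existsP => // -[m].
    by rewrite inord_val => h; rewrite (bigD1 m)//= h.
have eps01 : 0 < eps <= 1 by rewrite eps_gt0 (le_trans eps_le)//; lra.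
have := fill_after_reset D_gt0 eps01 (offset w) filler (greedy w) (i - t0) j W0.
rewrite subnKC// => /le_trans; apply.
by rewrite ler_wpM2l ?expR_ge0// lerD2r ler_wpM2r// ler_nat ltnW.
Qed.

(** The backlog depends only on the patterns and the selections up to step [i], which take finitely
    many values. *)
Lemma measurable_backlog x : measurable [set w | (backlog (state_of w) <= x)%R].
Proof.
pose g w := (patterns w, [ffun t : 'I_i.+1 => sel t w]).
pose h (y : {ffun J -> V} * {ffun 'I_i.+1 -> {set 'I_n}}) : R :=
  \big[Num.max/0]_(j < n) (poured_total c j i -
     (1 + D%:R^-1) * (\sum_(t < i) crossed_of y.1 j t.+1)%:R +
     D%:R^-1 * (load D (crossed_of y.1) (fun t => y.2 (inord t)) i j)%:R).
have -> : [set w | (backlog (state_of w) <= x)%R] = [set w | (h (g w) <= x)%R].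
  apply/seteqP; suff E w : backlog (state_of w) = h (g w) by split=> w /=; rewrite E.
  apply: eq_bigr => j _; rewrite (fill_run D_gt0 (offset w) pour01) /crossings.
  congr (_ - _ * _%:R + _ * _%:R).
    by apply: eq_bigr => t _; rewrite crosses_patterns.
  apply: (@load_ext _ _ i) => // [l t|t] /andP[_ ti]; first exact: crosses_patterns.
  by rewrite ffunE inordK.
apply: (@measurable_finite_valued _ _ _ g _ (fun y => (h y <= x)%R)) => -[f z].
have -> : [set w | g w = (f, z)] = [set w | patterns w = f] `&`
    \bigcap_(t in [set: 'I_i.+1]) [set w | sel t w = z t].
  apply/seteqP; split=> w /=; rewrite /g.
    by move=> [-> <-]; split=> // t _ /=; rewrite ffunE.
  by move=> [-> hz]; congr (_, _); apply/ffunP => t; rewrite ffunE; exact: hz.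
apply: measurableI; first exact: measurable_all_patterns.
by apply: fin_bigcap_measurable => //; exact: finite_finset.
Qed.

End Backlog.

(** * Choice of the constants and conclusion *)

Theorem theorem7p1 (R : realType) :
  exists alpha beta : R, [/\ 0 < alpha, 0 < beta &
  forall c : R, 0 < c ->
  exists C1 C2 : R, [/\ 0 < C1, 0 < C2 &
  forall (n p D : nat) (eps delta : R),
    (1 <= n)%N -> (1 <= p)%N ->
    p%:R `^ (- (1 / 3)) <= eps -> eps <= 1 / 2 ->
    p%:R `^ (- c) <= delta ->
    alpha * expR (- (beta * eps ^+ 2 * p%:R)) <= delta ->
    delta < 1 ->
    1 / delta = D%:R ->
  forall (d : measure_display) (T : measurableType d) (P : probability T R)
    (s : 'I_n -> nat -> {RV P >-> R}),
    random_offsets D s ->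
  forall pour : nat -> 'I_n -> R,
    oblivious_filler p eps pour ->
  forall sel : nat -> T -> {set 'I_n},
    (forall (i : nat) (A : {set 'I_n}), measurable [set w | sel i w = A]) ->
    (forall w : T,
       smoothed_greedy p D delta pour (fun j i => s j i w) (fun i => sel i w)) ->
  forall (i : nat) (k : R),
    ln p%:R <= k ->
    ((1 - C2 * expR (- expR k))%:E <=
     P [set w | (backlog (run D delta pour (fun j i' => s j i' w)
                            (fun i' => sel i' w) i) <= C1 * k / eps)%R])%E]].
Proof.
(* These are the constants of [tail_le], used in bounding the mean excess. *)
exists 64, (1 / 32); split=> // c c0.
(* The final exponent is [3 + 25 + 2 * k + 6 * c * k], and [28 <= 56 * k] since [k >= 1 / 2]. *)
exists (58 + 6 * c), 1; split=> //; first by lra.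
move=> n p D eps delta n1 p1 peps eps_le pdelta tail delta1 deltaD.
have p0 : (0 : R) < p%:R by rewrite ltr0n.
have delta_gt0 : 0 < delta by apply: lt_le_trans pdelta; exact: powR_gt0.
have deltaE : delta = D%:R^-1 by rewrite -deltaD div1r invrK.
have D1 : (1 < D)%N.
  by rewrite -(ltr_nat R) -deltaD ltr_pdivlMr// mul1r.
rewrite {}deltaE in pdelta tail delta1 delta_gt0 *.
have eps0 : 0 < eps by apply: lt_le_trans peps; exact: powR_gt0.
have eps2p : 1 <= eps ^+ 2 * p%:R.
  have cube : p%:R^-1 <= eps ^+ 3.
    have : (p%:R `^ (- (1 / 3))) ^+ 3 = p%:R^-1 :> R.
      rewrite -powR_mulrn ?powR_ge0// -powRrM mulNr mul1r mulVf// -powR_inv1//.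
    by move=> <-; rewrite lerXn2r ?nnegrE ?powR_ge0// ltW.
  have : 1 <= eps ^+ 3 * p%:R by rewrite -ler_pdivrMr// mul1r.
  move=> /le_trans; apply; rewrite ler_pM2r// exprS ler_piMl ?sqr_ge0//.
  by rewrite (le_trans eps_le)//; lra.
have p2 : 2 <= p%:R :> R.
  have : eps ^+ 2 * p%:R <= 1 / 2 * p%:R.
    rewrite ler_pM2r//; apply: (@le_trans _ _ (1 / 2 * (1 / 2))); last by lra.
    by rewrite expr2; apply: ler_pM => //; exact: ltW.
  by lra.
move=> d T P s offsets pour filler sel msel greedy i k lnpk.
have pk : p%:R <= expR k by rewrite -[leLHS]lnK ?posrE// ler_expR.
have k_ge : 1 / 2 <= k.
  have h : expR k * expR (- k) = 1 by rewrite -expRD subrr expR0.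
  have h1 : 2 * expR (- k) <= 1.
    by rewrite -[leRHS]h ler_pM2r ?expR_gt0// (le_trans p2 pk).
  by have := expR_ge1Dx (- k); lra.
set e := expR k in pk *; have e2 : 2 <= e by exact: le_trans p2 pk.
have d1 : D%:R^-1 <= 1 :> R by exact: ltW.
have d3 : 0 < D%:R^-1 ^+ 3 :> R by rewrite exprn_gt0.
have d3_le : D%:R^-1 ^+ 3 <= 1 :> R by rewrite exprn_ile1 ?ltW.
have [g [gE g0 g1 ginv]] : exists g : R, [/\ g = D%:R^-1 ^+ 3 / 2048, 0 < g, g <= 1 &
    g ^- 2 = 2 ^+ 22 * (D%:R^-1)^-1 ^+ 6].
  exists (D%:R^-1 ^+ 3 / 2048); split; [reflexivity|lra|lra|].
  rewrite exprMn invfM -!exprVn -!exprM.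
  by field; rewrite pnatr_eq0 -lt0n ltnW.
have M0 : 0 <= 2 * e / g ^+ 2 by rewrite divr_ge0 ?exprn_ge0 ?(ltW g0)// mulr_ge0// expR_ge0.
(* Then [g * M >= 2 * e / g], enough for both the target [e] and the loss [1 / g] of the union bound
   over reset times. *)
pose M := (Num.truncn (2 * e / g ^+ 2)).+1.
have /andP[Mle Mlt] := truncn_itv M0.
have failure : expR (- (g * M%:R)) * expR g^-1 <= expR (- e).
  rewrite -expRD ler_expR.
  have h1 : 2 * e / g <= g * M%:R.
    have -> : 2 * e / g = g * (2 * e / g ^+ 2) by field; rewrite gt_eqF.
    by rewrite ler_wpM2l ?(ltW g0)// ltW.
  have h2 : e <= e / g by rewrite ler_pdivlMr// ler_piMr// expR_ge0.
  have h3 : g^-1 <= e / g by rewrite ler_peMl ?invr_ge0 ?(ltW g0)//; lra.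
  lra.
(* Each factor is exponential in [k]: [p <= e], [D <= expR (c * k)] by the lower bound on [delta],
   and [M] is of order [e * D ^+ 6]. *)
have growth : expR (eps * 6) * (M%:R * p%:R + 1) <= expR ((58 + 6 * c) * k).
  have D0 : (0 : R) < D%:R by rewrite ltr0n ltnW.
  have dinv : (D%:R^-1)^-1 <= expR (c * k).
    rewrite -[leRHS]invrK lef_pV2 ?posrE ?invr_gt0 ?expR_gt0//.
    apply: le_trans pdelta; rewrite /powR gt_eqF// -expRN ler_expR mulNr lerN2.
    by rewrite ler_pM2l.
  have d6 : (D%:R^-1)^-1 ^+ 6 <= expR (6 * c * k).
    rewrite (_ : 6 * c * k = c * k * 6%:R); last by ring.
    by rewrite expRM_natr lerXn2r ?nnegrE ?expR_ge0// invrK ltW.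
  set x := expR (6 * c * k) in d6.
  have x1 : 1 <= x.
    rewrite -[leLHS]expR0 /x ler_expR mulr_ge0//; last by lra.
    by rewrite mulr_ge0// ltW.
  have e0 : 0 <= e by exact: expR_ge0.
  have Mx : M%:R <= 2 ^+ 24 * (e * x).
    have : 2 * e / g ^+ 2 <= 2 ^+ 23 * (e * x).
      rewrite ginv; have : e * (D%:R^-1)^-1 ^+ 6 <= e * x by rewrite ler_wpM2l.
      by lra.
    have : 1 <= e * x by rewrite -[leLHS]mulr1 ler_pM//; lra.
    by rewrite /M -[_.+1%:R]natr1; lra.
  have Mp : M%:R * p%:R + 1 <= 2 ^+ 25 * (e * e * x).
    have : M%:R * p%:R <= 2 ^+ 24 * (e * x) * e by apply: ler_pM.
    have : 1 <= e * e * x by rewrite -[leLHS]mulr1 ler_pM// -[leLHS]mulr1 ler_pM//; lra.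
    by lra.
  have two : 2 ^+ 25 <= expR 25 :> R.
    rewrite -[X in expR X]mul1r expRM_natr lerXn2r ?nnegrE ?expR_ge0//.
    by have := expR_ge1Dx (1 : R); lra.
  apply: (@le_trans _ _ (expR 3 * (expR 25 * (e * e * x)))).
    apply: ler_pM; rewrite ?expR_ge0 ?addr_ge0 ?mulr_ge0//.
      by rewrite ler_expR; move: eps_le; lra.
    by apply: le_trans Mp _; rewrite ler_wpM2r// !mulr_ge0// expR_ge0.
  rewrite /e /x -!expRD ler_expR; move: k_ge; lra.
set A := [set w | _].
have mA : measurable A.
  exact: (measurable_backlog D1 offsets filler msel).
rewrite mul1r -[A]setCK probability_setC; last exact: measurableC.
rewrite EFinB leeB//.
apply: (@le_trans _ _ (P [set w | long_overload p D eps M (all_patterns D pour i s w)])).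
  apply: le_measure; rewrite ?inE; first exact: measurableC.
    apply: (measurable_finite_valued (fun f => measurable_all_patterns D pour s f)).
  move=> w nA; apply: contrapT => /negP nbad; apply: nA.
  have c0k : 0 <= (58 + 6 * c) * k / eps.
    by rewrite divr_ge0 ?(ltW eps0)// mulr_ge0//; lra.
  apply: bigmax_le => // j _; rewrite ler_pdivlMr// mulrC -ler_expR.
  apply: le_trans growth.
  exact: (fill_not_overloaded D1 eps0 eps_le offsets filler greedy).
apply: le_trans (long_overload_prob D1 eps0 eps_le eps2p tail offsets filler i M) _.
by rewrite -gE lee_fin.
Qed.
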